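(* Let $A$ be a unital $C^*$-algebra. Then the following conditions are equivalent: (i) The squaring map $x\mapsto x^2$ from $A_{\mathrm{sa}}$ to $A_+$ is open. (ii) $A$ is commutative and $\operatorname{RR}(A)=0$. (iii) $A$ is isomorphic to a $C^*$-algebra of the form $C(X)$ for a compact Hausdorff space $X$ with $\dim X=0$.
   Context: For a $C^*$-algebra $A$, $A_{\mathrm{sa}}$ denotes the set of self-adjoint elements and $A_+$ the set of positive elements of $A$, both with the norm topology inherited from $A$. A map $A_{\mathrm{sa}}\to A_+$ is open if it sends open subsets of $A_{\mathrm{sa}}$ to sets that are (relatively) open in $A_+$. Thus the squaring map is open iff for every $x\in A_{\mathrm{sa}}$ and every $\varepsilon>0$ there is $\delta>0$ such that for every $a\in A_+$ with $\|x^2-a\|<\delta$ there is $y\in A_{\mathrm{sa}}$ with $y^2=a$ and $\|x-y\|<\varepsilon$. Real rank: for a unital $C^*$-algebra $A$ and a non-negative integer $n$, $\operatorname{RR}(A)\le n$ if for every $(n+1)$-tuple $(x_1,\dots,x_{n+1})$ in $A_{\mathrm{sa}}$ and every $\varepsilon>0$ there is an $(n+1)$-tuple $(y_1,\dots,y_{n+1})$ in $A_{\mathrm{sa}}$ such that $\sum_{k=1}^{n+1}y_k^2$ is invertible and $\sum_{k=1}^{n+1}\|x_k-y_k\|<\varepsilon$. $\operatorname{RR}(A)$ is the least such $n$; so $\operatorname{RR}(A)=0$ means that the invertible self-adjoint elements are dense in $A_{\mathrm{sa}}$. $C(X)$ is the $C^*$-algebra of continuous complex-valued functions on $X$. Lebesgue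 dimension: for a non-negative integer $n$, a compact Hausdorff space $X$ has $\dim X\le n$ if for every closed subset $F$ of $X$, each continuous map $F\to S^n$ has a continuous extension $X\to S^n$, where $S^n$ is the unit sphere in $\mathbb{R}^{n+1}$ (so $S^0=\{-1,1\}$); $\dim X$ is the least non-negative integer $n$ with $\dim X \le n$ (and $\infty$ if there is none). *)

(* Defs.v *)
From HB Require Import structures.
From mathcomp Require Import all_boot all_order all_algebra.
From mathcomp Require Import all_classical all_reals all_analysis.
From mathcomp Require Import complex.

Set Implicit Arguments.
Unset Strict Implicit.
Unset Printing Implicit Defensive.
Import Order.TTheory GRing.Theory Num.Theory.
Import numFieldNormedType.Exports.

Local Open Scope classical_set_scope.
Local Open Scope ring_scope.
Local Open Scope complex_scope.

(* Stating this at type numClosedFieldType gives access to the norm and the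
   topology that the library puts on every numClosedFieldType. *)
Definition Cplx (R : realType) : numClosedFieldType := R[i].

(* A complex Banach space with an associative unital product and an
   involution.  The product is not the one of a pzRingType because the library
   has no common structure for rings and normed modules besides the numeric
   fields.  Norms in a completeNormedModType over C are elements of C (real and
   nonnegative).  The zero algebra is allowed. *)
HB.mixin Record isCstarAlgebra (R : realType) A
    of CompleteNormedModule (Cplx R) A := {
  cmul : A -> A -> A ;
  cone : A ;
  cmulA : associative cmul ;
  cmul1x : left_id cone cmul ;
  cmulx1 : right_id cone cmul ;
  cmulDl : left_distributive cmul +%R ;
  cmulDr : right_distributive cmul +%R ;
  cmulZl : forall (k : Cplx R) (x y : A), cmul (k *: x) y = k *: cmul x y ;
  cmulZr : forall (k : Cplx R) (x y : A), cmul x (k *: y) = k *: cmul x y ;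
  star : A -> A ;
  starK : involutive star ;
  starD : {morph star : x y / x + y} ;
  starZ : forall (k : Cplx R) (x : A), star (k *: x) = Num.conj k *: star x ;
  starM : forall x y : A, star (cmul x y) = cmul (star y) (star x) ;
  norm_cmul : forall x y : A, `|cmul x y| <= `|x| * `|y| ;
  norm_star_cmul : forall x : A, `|cmul (star x) x| = `|x| ^+ 2
}.

#[short(type="cstarAlgType")]
HB.structure Definition CstarAlgebra (R : realType) :=
  {A of isCstarAlgebra R A & CompleteNormedModule (Cplx R) A}.

Section Cstar.
Context {R : realType} (A : cstarAlgType R).

Definition self_adjoint : set A := [set x | star x = x].

Definition invertible (x : A) : Prop :=
  exists y : A, cmul x y = cone /\ cmul y x = cone.

Definition spectrum (x : A) : set (Cplx R) :=
  [set k | ~ invertible (x - k *: cone)].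

(* In the order of C, 0 <= k means that k is real and nonnegative. *)
Definition positive_elts : set A :=
  [set x | self_adjoint x /\ forall k, spectrum x k -> 0 <= k].

Definition square (x : A) : A := cmul x x.

Definition commutative_alg : Prop := forall x y : A, cmul x y = cmul y x.

Definition real_rank_le (n : nat) : Prop :=
  forall x : 'I_n.+1 -> A, (forall i, self_adjoint (x i)) ->
  forall e : R, 0 < e ->
  exists y : 'I_n.+1 -> A,
    [/\ forall i, self_adjoint (y i),
        invertible (\sum_i square (y i)) &
        \sum_i `|x i - y i| < (e%:C : Cplx R)].

Definition real_rank_eq (n : nat) : Prop :=
  real_rank_le n /\ forall m, real_rank_le m -> (n <= m)%N.

End Cstar.

Definition relatively_open {T : topologicalType} (S U : set T) : Prop :=
  exists2 V, open V & U = V `&` S.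

(* As U ranges over all relatively open subsets of S, including S itself, this
   also says that f maps S into S'. *)
Definition open_map_on {T T' : topologicalType} (S : set T) (S' : set T')
    (f : T -> T') : Prop :=
  forall U, relatively_open S U -> relatively_open S' (f @` U).

Definition unit_sphere (R : realType) (n : nat) : set 'rV[R]_n.+1 :=
  [set v | \sum_i v ord0 i ^+ 2 = 1].
Arguments unit_sphere : clear implicits.

Section Dimension.
Context (R : realType) (X : topologicalType).

(* A map from F to the sphere is given by a total function, of which only the
   restriction to F matters. *)
Definition lebesgue_dim_le (n : nat) : Prop :=
  forall (F : set X) (f : X -> 'rV[R]_n.+1),
    closed F -> {within F, continuous f} -> f @` F `<=` unit_sphere R n ->
  exists g : X -> 'rV[R]_n.+1,
    [/\ continuous g, range g `<=` unit_sphere R n & {in F, g =1 f}].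

Definition lebesgue_dim_eq (n : nat) : Prop :=
  lebesgue_dim_le n /\ forall m, lebesgue_dim_le m -> (n <= m)%N.

End Dimension.

(* C(X) is the type continuousType X C with pointwise operations.  An
   isomorphism of C*-algebras is a bijective *-homomorphism (it is then
   automatically isometric). *)
Definition star_iso_CX {R : realType} (A : cstarAlgType R) (X : topologicalType)
    (phi : A -> continuousType X (Cplx R)) : Prop :=
  bijective phi /\
  forall (x y : A) (k : Cplx R) (t : X),
    [/\ phi (x + y) t = phi x t + phi y t,
        phi (k *: x) t = k * phi x t,
        phi (cmul x y) t = phi x t * phi y t &
        phi (star x) t = Num.conj (phi x t)].

(* Main.v *)
Require Import Defs.
From HB Require Import structures.
From mathcomp Require Import all_boot all_order all_algebra.
From mathcomp Require Import all_classical all_reals all_analysis.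
From mathcomp Require Import complex ring lra.

(** The characterization rests on an elementary study of the squares of self-adjoint
    elements, from which the spectral facts are deduced without complex function
    theory.  Square roots of [1 - x], for [x] self-adjoint of norm at most [1], come
    from an iteration ([sqrt_1B]).  If [p] and [q] are commuting self-adjoint elements
    with [p ^ 2 + q ^ 2 = 1], then [p + i q] is unitary, which bounds the norm of [p]
    ([norm_le1_of_sum_sqr]).  It follows that squares are described by a norm condition
    and are stable under sums ([isqD]), that the norm is determined by the order given
    by squares ([norm_le_of_order]), that [nrm b ^ 2 - b ^ 2] is never invertible for
    self-adjoint nonzero [b] ([not_inv_norm_sqr]), and that the positive elements are
    the squares of self-adjoint elements ([positive_isq]).

    Suppose that squaring is open.  A root near [x] of [x ^ 2] plus a small constant is
    invertible, so the real rank is zero ([open_real_rank0]).  If [s] is a self-adjoint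
    element of square [1], then for self-adjoint [b] the element [1 + t b] has roots
    near [s], and these commute with [b]; hence [s] is central
    ([open_symmetry_central]).  In real rank zero every self-adjoint element is a limit
    of linear combinations of such [s] ([central_dense]), so the algebra is
    commutative.

    Suppose that the algebra is commutative of real rank zero.  Characters are obtained
    from maximal orderings instead of maximal ideals ([ordering_total], [valM]), and
    there are enough of them to determine the norm ([exists_char], [nrm_le_ev]).  The
    root of [a] near [x] is [s] times the positive root of [a], where [s] is the sign of
    an invertible element near [x]; the estimate is one between real numbers at every
    character ([real_rank0_open]).  The characters form a compact Hausdorff space.  The
    self-adjoint elements are a complete lattice-ordered space of functions on it which
    interpolates at pairs of points, so the Stone-Weierstrass argument shows that every
    continuous function comes from the algebra ([evp_surj], [gelfand_star_iso]).  Signs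
    of invertible elements extend maps to the two-point sphere, so that the dimension
    is zero ([lebesgue_dim_char_space]).

    Conversely, on a zero-dimensional space the sign of a real function [u], restricted
    to the set where [|u|] is at least [g], extends to the whole space, and this yields
    an invertible function near [u] ([CX_real_rank0]). *)

Set Implicit Arguments.
Unset Strict Implicit.
Unset Printing Implicit Defensive.
Import Order.TTheory GRing.Theory Num.Theory.
Import numFieldNormedType.Exports.

Local Open Scope classical_set_scope.
Local Open Scope ring_scope.

(** * The ring structure and the real-valued norm *)

(** The carrier under a name of its own, to which a ring structure is attached. *)
Definition alg (R : realType) (A : cstarAlgType R) : Type := A.

Section Ring.
Context (R : realType) (A : cstarAlgType R).
HB.instance Definition _ := CompleteNormedModule.copy (alg A) A.

HB.instance Definition _ := GRing.Zmodule_isPzRing.Build (alg A)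
  (@cmulA R A) (@cmul1x R A) (@cmulx1 R A) (@cmulDl R A) (@cmulDr R A).

End Ring.

Section Basics.
Context (R : realType) (A : cstarAlgType R).
Local Notation C := (Cplx R).
Local Notation B := (alg A).
Implicit Types (x y z a b : B) (k : C) (r t : R).

Definition cscal (k : C) : B := k *: (1 : B).
Definition rscal (r : R) : B := cscal (r%:C)%C.
Definition st (x : B) : B := @star R A x.
Definition nrm (x : B) : R := complex.Re (`|x| : C).

Lemma scaleE k x : k *: x = cscal k * x.
Proof. by rewrite /cscal [RHS](@cmulZl R A); congr (_ *: _); rewrite [RHS]mul1r. Qed.
Lemma scaleEr k x : k *: x = x * cscal k.
Proof. by rewrite /cscal [RHS](@cmulZr R A); congr (_ *: _); rewrite [RHS]mulr1. Qed.
Lemma cscalC k x : cscal k * x = x * cscal k.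
Proof. by rewrite -scaleE scaleEr. Qed.
Lemma rscalE r : rscal r = cscal (r%:C)%C. Proof. by []. Qed.
Lemma rscalC r x : rscal r * x = x * rscal r.
Proof. exact: cscalC. Qed.

Fact cscal_zmod_morphism : zmod_morphism cscal.
Proof. by move=> k l; rewrite /cscal scalerBl. Qed.
HB.instance Definition _ := GRing.isZmodMorphism.Build C B cscal cscal_zmod_morphism.
Fact cscal_monoid_morphism : monoid_morphism cscal.
Proof. by split=> [|k l]; rewrite -?scaleE /cscal ?scale1r // -scalerA. Qed.
HB.instance Definition _ := GRing.isMonoidMorphism.Build C B cscal cscal_monoid_morphism.
HB.instance Definition _ := GRing.RMorphism.copy rscal (cscal \o (real_complex R : R -> C)).

Fact st_zmod_morphism : zmod_morphism st.
Proof.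
move=> x y; rewrite /st -scaleN1r [star _]starD; congr (_ + _).
by rewrite [LHS]starZ rmorphN1 scaleN1r.
Qed.
HB.instance Definition _ := GRing.isZmodMorphism.Build B B st st_zmod_morphism.

Lemma stK : involutive st. Proof. exact: starK. Qed.
Lemma stM x y : st (x * y) = st y * st x. Proof. exact: starM. Qed.
Lemma st1 : st 1 = 1.
Proof. by rewrite -[LHS]mulr1 -[X in _ * X](stK 1) -stM mulr1 stK. Qed.
Lemma st_cscal k : st (cscal k) = cscal (Num.conj k).
Proof. by rewrite /cscal -{2}st1 [LHS]starZ. Qed.
Lemma st_rscal r : st (rscal r) = rscal r.
Proof. by rewrite st_cscal; congr cscal; apply/eqP; rewrite eq_complex/= oppr0 !eqxx. Qed.

Lemma nrmE x : `|x| = (nrm x)%:C%C.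
Proof.
have := normr_ge0 x; rewrite /nrm; case: (`|x|) => a b.
by rewrite lecE/= => /andP[/eqP-> _].
Qed.
Lemma nrm_ge0 x : 0 <= nrm x.
Proof. by have := normr_ge0 x; rewrite nrmE lecR. Qed.
Lemma nrm_le_add x y : nrm (x + y) <= nrm x + nrm y.
Proof. by have := ler_normD x y; rewrite !nrmE -rmorphD lecR. Qed.
Lemma nrmN x : nrm (- x) = nrm x.
Proof. by rewrite /nrm normrN. Qed.
Lemma nrm_le_sub x y : nrm (x - y) <= nrm x + nrm y.
Proof. by rewrite -[nrm y]nrmN nrm_le_add. Qed.
Lemma nrmC x y : nrm (x - y) = nrm (y - x).
Proof. by rewrite -nrmN opprB. Qed.
Lemma nrm_le_mul x y : nrm (x * y) <= nrm x * nrm y.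
Proof. by have := @norm_cmul R A x y; rewrite !nrmE -rmorphM lecR. Qed.
Lemma nrm_star_mul x : nrm (st x * x) = nrm x ^+ 2.
Proof. by have := @norm_star_cmul R A x; rewrite !nrmE -rmorphXn => -[]. Qed.
Lemma nrm_sqr x : st x = x -> nrm (x * x) = nrm x ^+ 2.
Proof. by move=> e; rewrite -nrm_star_mul e. Qed.
Lemma nrm0 : nrm 0 = 0. Proof. by rewrite /nrm normr0. Qed.
Lemma nrm_eq0 x : (nrm x == 0) = (x == 0).
Proof. by rewrite -[x == 0]normr_eq0 nrmE eq_complex/= eqxx andbT. Qed.
Lemma nrm_gt0 x : x != 0 -> 0 < nrm x.
Proof. by move=> x0; rewrite lt_neqAle eq_sym nrm_eq0 x0 nrm_ge0. Qed.
Lemma nrm1_le : nrm 1 <= 1.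
Proof.
have := nrm_star_mul 1; rewrite st1 mulr1 => e.
have := nrm_ge0 1; nra.
Qed.
Lemma nrm_rscalM r x : nrm (rscal r * x) = `|r| * nrm x.
Proof.
by rewrite -[rscal r * x]scaleE /nrm normrZ nrmE normc_def/= expr0n addr0 sqrtr_sqr mul0r subr0.
Qed.
Lemma nrm_rscal_le r : nrm (rscal r) <= `|r|.
Proof. by rewrite -[rscal r]mulr1 nrm_rscalM ler_piMr ?nrm1_le. Qed.
Lemma nrm_st x : nrm (st x) = nrm x.
Proof.
have h y : nrm y <= nrm (st y).
  have := nrm_le_mul (st y) y; rewrite nrm_star_mul.
  have := nrm_ge0 y; have := nrm_ge0 (st y); nra.
by apply/le_anti; rewrite h -{2}[x]stK h.
Qed.
End Basics.

(** * Limits, square roots and the geometric series *)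

Section Limits.
Context (R : realType) (A : cstarAlgType R).
Local Notation C := (Cplx R).
Local Notation B := (alg A).
Implicit Types (x y z a b : B) (k : C) (r t : R) (u : nat -> B).

(** Radii of balls are positive elements of C, hence positive reals. *)
Lemma Cplx_gt0 (k : C) : 0 < k -> exists2 r : R, 0 < r & k = (r%:C)%C.
Proof. by case: k => a b; rewrite ltcE/= => /andP[/eqP-> ?]; exists a. Qed.

Lemma nrm_ballP x (e : R) y : ball x (e%:C%C : C) y <-> nrm (x - y) < e.
Proof. by rewrite -ball_normE/= nrmE ltcR. Qed.

Definition limto u x := forall e, 0 < e -> exists N, forall n, (N <= n)%N -> nrm (u n - x) < e.

(** The majorant [t] is monotone and bounded, hence a Cauchy sequence, and [u]
    inherits this from it. *)
Lemma dominated_limto u (t : nat -> R) (T : R) :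
  (forall n, nrm (u n.+1 - u n) <= t n.+1 - t n) -> (forall n, t n <= T) ->
  exists x, limto u x.
Proof.
move=> ut tT.
have t_hom m n : (m <= n)%N -> nrm (u n - u m) <= t n - t m.
  move=> /subnK <-; elim: (n - m)%N => [|d ih]; first by rewrite add0n !subrr nrm0.
  have -> : u (d.+1 + m)%N - u m = (u (d + m).+1 - u (d + m)%N) + (u (d + m)%N - u m).
    by rewrite addrA subrK.
  rewrite (le_trans (nrm_le_add _ _))//; have := ut (d + m)%N; rewrite addSn; lra.
pose S := range t.
have hS : has_sup S by split; [exists (t 0%N), 0%N | exists T => _ [n _ <-]].
have cau (e : R) : 0 < e -> exists N, forall m n, (N <= m)%N -> (N <= n)%N -> nrm (u m - u n) < e.
  move=> e0; have [_ [N _ <-] hN] := sup_adherent e0 hS.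
  exists N => m n; wlog hm : m n / (m <= n)%N => [W|] hN' hN2.
    by case: (leqP m n) => [|/ltnW] h; [exact: W | rewrite nrmC; exact: W].
  rewrite nrmC (le_lt_trans (t_hom _ _ hm))//.
  have tn : t n <= sup S by apply: ub_le_sup; [case: hS | exists n].
  have tm : t N <= t m by rewrite -subr_ge0 (le_trans _ (t_hom _ _ hN')) ?nrm_ge0.
  lra.
have : cvg (u @ \oo).
  apply: cauchy_cvg; apply/cauchy_ballP => e /Cplx_gt0[r r0 ->].
  have [N hN] := cau _ r0.
  pose V := [set y | exists2 n, (N <= n)%N & u n = y].
  exists (V, V) => /=; last by move=> _ [[m hm <-] [n hn <-]]; apply/nrm_ballP/hN.
  by split; exists N => // n hn; exists n.
move=> /cvg_ex[/= l /cvg_ballP cl]; exists l => e e0.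
have /cl[N _ hN] : 0 < (e%:C%C : C) by rewrite ltcR.
by exists N => n /hN /= /nrm_ballP; rewrite nrmC.
Qed.

Lemma limto_shift u x : limto u x -> limto (fun n => u n.+1) x.
Proof. by move=> h e /h[N hN]; exists N => n Nn; apply: hN; rewrite leqW. Qed.

Lemma limto_unique u x y : limto u x -> limto u y -> x = y.
Proof.
move=> hx hy; apply/eqP; rewrite -subr_eq0 -nrm_eq0; apply: contraT => h.
have e0 : 0 < nrm (x - y) / 2 by rewrite divr_gt0// lt_neqAle eq_sym h nrm_ge0.
have [N hN] := hx _ e0; have [M hM] := hy _ e0.
have := hN _ (leq_maxl N M); have := hM _ (leq_maxr N M).
set v := u _; have := nrm_le_add (x - v) (v - y).
by rewrite addrA subrK (nrmC x v); lra.
Qed.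

Lemma limtoD u v x y : limto u x -> limto v y -> limto (fun n => u n + v n) (x + y).
Proof.
move=> hx hy e e0; have e2 : 0 < e / 2 by rewrite divr_gt0.
have [N hN] := hx _ e2; have [M hM] := hy _ e2.
exists (maxn N M) => n; rewrite geq_max => /andP[/hN h1 /hM h2].
rewrite opprD addrACA (le_lt_trans (nrm_le_add _ _))//; lra.
Qed.

Lemma limto_cst x : limto (fun=> x) x.
Proof. by move=> e e0; exists 0%N => n _; rewrite subrr nrm0. Qed.

Lemma limto_mull u x z : limto u x -> limto (fun n => z * u n) (z * x).
Proof.
move=> h e e0; have z0 : 0 < nrm z + 1 by rewrite ltr_wpDl ?nrm_ge0.
have [N hN] := h (e / (nrm z + 1)) ltac:(by rewrite divr_gt0).
exists N => n /hN; rewrite -mulrBr ltr_pdivlMr// => h1.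
apply: le_lt_trans (nrm_le_mul _ _) _; have := nrm_ge0 (u n - x); lra.
Qed.

Lemma limto_mulr u x z : limto u x -> limto (fun n => u n * z) (x * z).
Proof.
move=> h e e0; have z0 : 0 < nrm z + 1 by rewrite ltr_wpDl ?nrm_ge0.
have [N hN] := h (e / (nrm z + 1)) ltac:(by rewrite divr_gt0).
exists N => n /hN; rewrite -mulrBl ltr_pdivlMr// => h1.
apply: le_lt_trans (nrm_le_mul _ _) _; have := nrm_ge0 (u n - x); lra.
Qed.

Lemma limto_st u x : limto u x -> limto (fun n => st (u n)) (st x).
Proof. by move=> h e /h[N hN]; exists N => n /hN; rewrite -raddfB nrm_st. Qed.

Lemma limto_nrm_le u x r : limto u x -> (forall n, nrm (u n) <= r) -> nrm x <= r.
Proof.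
move=> h hr; rewrite leNgt; apply/negP => hx.
have [N hN] := h (nrm x - r) ltac:(by rewrite subr_gt0).
have := hN N (leqnn N); have := hr N; have := nrm_le_sub (u N) (u N - x).
by rewrite opprB addrC subrK; lra.
Qed.

Lemma limto_sqr u x : limto u x -> (forall n, nrm (u n) <= 1) ->
  limto (fun n => u n * u n) (x * x).
Proof.
move=> h h1 e e0; have [N hN] := h _ (divr_gt0 e0 (ltr0n _ 2)).
have x1 := limto_nrm_le h h1.
exists N => n /hN hn.
have -> : u n * u n - x * x = u n * (u n - x) + (u n - x) * x.
  by rewrite mulrBr mulrBl addrA subrK.
apply: le_lt_trans (nrm_le_add _ _) _.
have := nrm_le_mul (u n) (u n - x); have := nrm_le_mul (u n - x) x.
have := h1 n; have := nrm_ge0 (u n - x); have := nrm_ge0 x; have := nrm_ge0 (u n); nra.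
Qed.

(** [y] lies in the bicommutant of [x].  This is what is remembered of the fact
    that a square root is a limit of polynomials in the given element. *)
Definition bicommutant x y := forall z, GRing.comm z x -> GRing.comm z y.

Lemma comm_rscal z r : GRing.comm z (rscal A r).
Proof. by rewrite /GRing.comm rscalC. Qed.

Lemma bicommutant_comm x y z : bicommutant x y -> bicommutant x z -> GRing.comm y z.
Proof. by move=> hy hz; apply: hz; apply/commr_sym/hy. Qed.

Lemma comm_limto v u y : (forall n, GRing.comm v (u n)) -> limto u y -> GRing.comm v y.
Proof.
move=> h hu; apply: (limto_unique (limto_mull v hu)) => e e0.
have [N hN] := limto_mulr v hu e0.
by exists N => n /hN; rewrite h.
Qed.

Lemma comm_subr_sqr x y : GRing.comm x y -> x * x - y * y = (x - y) * (x + y).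
Proof. by move=> h; rewrite mulrBl !mulrDr -h addrKA. Qed.

Lemma rscal_half x : rscal A 2^-1 * (x + x) = x.
Proof.
rewrite mulrDr -mulrDl -rmorphD/=.
by have -> : 2^-1 + 2^-1 = 1 :> R; [lra | rewrite rmorph1 mul1r].
Qed.

(** A fixed point [y] of the map taking [y] to [(x + y ^ 2) / 2] satisfies
    [(1 - y) ^ 2 = 1 - x].  The iterates from [0] are polynomials in [x] with
    nonnegative coefficients; hence their increments are dominated by those of the
    same iteration for the real number [1], which increases and stays below [1]. *)
Lemma sqrt_1B x : st x = x -> nrm x <= 1 ->
  exists w, [/\ st w = w, w * w = 1 - x, nrm (1 - w) <= 1 & bicommutant x w].
Proof.
move=> sx x1.
pose f y := rscal A 2^-1 * (x + y * y) : B.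
pose g (t : R) := 2^-1 * (1 + t * t).
pose u n := iter n f 0; pose t n := iter n g 0.
have t01 n : 0 <= t n <= 1.
  by elim: n => [|n]; rewrite ?lexx ?ler01// /t/= -/(t n) /g => /andP[h0 h1]; apply/andP; split; nra.
have ut n : nrm (u n) <= t n.
  elim: n => [|n ih]; first by rewrite nrm0.
  rewrite /u/t/= -/(u n) -/(t n) /f /g nrm_rscalM ger0_norm//.
  rewrite ler_pM2l//; apply: le_trans (nrm_le_add _ _) _.
  have := nrm_le_mul (u n) (u n); have := nrm_ge0 (u n); nra.
have bu n : bicommutant x (u n).
  elim: n => [|n ih] z xz; first exact: commr0.
  by apply: commrM; [exact: comm_rscal | apply: commrD => //; apply: commrM; apply: ih].
have uu n m : GRing.comm (u n) (u m) by apply: (bicommutant_comm (bu n)).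
have su n : st (u n) = u n.
  elim: n => [|n ih]; first by rewrite raddf0.
  by rewrite /u/= -/(u n) /f stM st_rscal raddfD/= stM ih sx rscalC.
have dut n : nrm (u n.+1 - u n) <= t n.+1 - t n.
  elim: n => [|n ih]; first by rewrite !subr0; exact: (ut 1%N).
  have -> : u n.+2 - u n.+1 = rscal A 2^-1 * ((u n.+1 - u n) * (u n.+1 + u n)).
    rewrite -comm_subr_sqr// {1}/u/= -/(u n.+1) {2}/u/= -/(u n) /f -mulrBr.
    by rewrite opprD addrACA subrr add0r.
  have -> : t n.+2 - t n.+1 = 2^-1 * ((t n.+1 - t n) * (t n.+1 + t n)).
    by rewrite {1}/t/= -/(t n.+1) {2}/t/= -/(t n) /g; ring.
  rewrite nrm_rscalM ger0_norm// ler_pM2l//; apply: le_trans (nrm_le_mul _ _) _.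
  rewrite ler_pM ?nrm_ge0//; apply: le_trans (nrm_le_add _ _) _.
  by rewrite lerD.
have [y uy] : exists y, limto u y.
  by apply: (dominated_limto dut (T := 1)) => n; have /andP[] := t01 n.
have u1 n : nrm (u n) <= 1 by rewrite (le_trans (ut n))//; have /andP[] := t01 n.
have ey : y = rscal A 2^-1 * (x + y * y).
  apply: (limto_unique (limto_shift uy)).
  exact/limto_mull/limtoD/limto_sqr/u1/uy/limto_cst.
have eyy : y + y = x + y * y by rewrite {1 2}ey -mulrDr rscal_half.
exists (1 - y); split.
- rewrite raddfB/= st1; congr (_ - _); apply: (limto_unique _ uy).
  by have := limto_st uy; congr limto; apply/funext => n.
- have -> : x = y + y - y * y by rewrite eyy addrK.
  by rewrite mulrBl mul1r mulrBr mulr1 -addrA -opprD addrA.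
- by rewrite opprB addrC subrK (limto_nrm_le uy).
- move=> z xz; apply: commrB; first exact: commr1.
  by apply: comm_limto uy => n; apply: bu.
Qed.

(** The increments of the geometric series are dominated by those of the real
    geometric series of ratio [nrm x]. *)
Lemma neumann x : nrm x < 1 -> exists y, (1 - x) * y = 1 /\ y * (1 - x) = 1.
Proof.
move=> x1; pose f y := 1 + x * y : B; pose u n := iter n f 0.
(* [t n] is the sum of the first [n] powers of the norm of [x] *)
pose t n : R := (1 - nrm x ^+ n) / (1 - nrm x).
have cu n : GRing.comm x (u n).
  elim: n => [|n ih]; first exact: commr0.
  by apply: commrD; [exact: commr1 | exact: commrM].
have dut n : nrm (u n.+1 - u n) <= t n.+1 - t n.
  have -> : t n.+1 - t n = nrm x ^+ n by rewrite /t exprS; field; lra.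
  elim: n => [|n ih]; first by rewrite /u/= /f mulr0 addr0 subr0 nrm1_le.
  have -> : u n.+2 - u n.+1 = x * (u n.+1 - u n).
    by rewrite mulrBr [LHS](_ : _ = f (u n.+1) - f (u n))// /f opprD addrACA subrr add0r.
  by rewrite exprS (le_trans (nrm_le_mul _ _))// ler_wpM2l ?nrm_ge0.
have [|y uy] := dominated_limto dut (T := (1 - nrm x)^-1).
  move=> n; rewrite /t ler_pdivrMr ?mulVf; [|lra..].
  by rewrite lerBlDr lerDl exprn_ge0 ?nrm_ge0.
have ey : y = 1 + x * y.
  apply: (limto_unique (limto_shift uy)).
  exact/limtoD/limto_mull/uy/limto_cst.
have e1 : (1 - x) * y = 1 by rewrite mulrBl mul1r {1}ey addrK.
exists y; split => //; rewrite -[RHS]e1 mulrBl mulrBr mulr1 mul1r; congr (_ - _).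
by apply/esym/(comm_limto cu).
Qed.
End Limits.

(** * Squares of self-adjoint elements, norm and spectrum *)

Section Positivity.
Context (R : realType) (A : cstarAlgType R).
Local Notation C := (Cplx R).
Local Notation B := (alg A).
Implicit Types (x y z a b : B) (k : C) (r t m e : R).

Local Notation rscal := (rscal A).

Definition sa x := st x = x.

Definition re_part x : B := rscal 2^-1 * (x + st x).
Definition im_part x : B := rscal 2^-1 * (- cscal A ('i%C : C) * (x - st x)).

(** An algebraic form of positivity; by [positive_isq] it agrees with positivity of
    the spectrum. *)
Definition isq a := exists2 b, sa b & a = b * b.

Lemma sa_rscal r : sa (rscal r). Proof. exact: st_rscal. Qed.
Lemma saD x y : sa x -> sa y -> sa (x + y).
Proof. by rewrite /sa raddfD/= => -> ->. Qed.
Lemma saN x : sa x -> sa (- x).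
Proof. by rewrite /sa raddfN/= => ->. Qed.
Lemma saB x y : sa x -> sa y -> sa (x - y).
Proof. by move=> hx hy; apply: saD hx (saN hy). Qed.
Lemma saM x y : sa x -> sa y -> GRing.comm x y -> sa (x * y).
Proof. by rewrite /sa stM => -> -> ->. Qed.
Lemma saZ r x : sa x -> sa (rscal r * x).
Proof. by move=> h; apply: saM (sa_rscal r) h (rscalC r x). Qed.
Lemma sa1 : sa (1 : B). Proof. exact: st1. Qed.
Lemma isq_sa a : isq a -> sa a.
Proof. by case=> b hb ->; apply: saM. Qed.

Lemma rscalV r : r != 0 -> rscal r^-1 * rscal r = 1.
Proof. by move=> r0; rewrite -rmorphM/= mulVf// rmorph1. Qed.

Lemma comm_mulACA (x y : B) : GRing.comm x y -> x * y * (x * y) = x * x * (y * y).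
Proof. by move=> h; rewrite mulrA -[x * y * x]mulrA -h mulrA -mulrA. Qed.

Lemma rscal_mulACA r x y : rscal r * x * (rscal r * y) = rscal (r * r) * (x * y).
Proof. by rewrite rmorphM/= !mulrA; congr (_ * _); rewrite -!mulrA; congr (_ * _); rewrite rscalC. Qed.

Lemma rscalMA r t x : rscal r * (rscal t * x) = rscal (r * t) * x.
Proof. by rewrite mulrA -rmorphM. Qed.

Lemma cscal_ii : cscal A ('i%C : C) * cscal A ('i%C : C) = -1.
Proof. by rewrite -rmorphM/= -expr2 sqr_i rmorphN1. Qed.

Lemma st_ci : st (cscal A ('i%C : C)) = - cscal A ('i%C : C).
Proof.
rewrite st_cscal -rmorphN; congr cscal; apply/eqP.
by rewrite eq_complex/= oppr0 !eqxx.
Qed.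

Lemma sa_re_part x : sa (re_part x).
Proof. by apply: saZ; rewrite /sa raddfD/= stK addrC. Qed.

Lemma sa_im_part x : sa (im_part x).
Proof.
apply: saZ; rewrite /sa mulNr raddfN/= stM raddfB/= stK st_ci mulrN opprK.
by rewrite -cscalC -mulrN opprB.
Qed.

Lemma re_im_partE x : x = re_part x + cscal A ('i%C : C) * im_part x.
Proof.
rewrite /re_part /im_part mulrA -rscalC -mulrA mulNr mulrN mulrA cscal_ii mulN1r opprK.
by rewrite -mulrDr addrACA subrr addr0 rscal_half.
Qed.

(** The element [p + i q] is unitary, so its norm is at most [1], and [p] is its real
    part. *)
Lemma norm_le1_of_sum_sqr p q : sa p -> sa q -> GRing.comm p q ->
  p * p + q * q = 1 -> nrm p <= 1.
Proof.
move=> sp sq pq e; pose j : B := cscal A ('i%C : C).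
have jj : j * j = -1 by exact: cscal_ii.
pose u := p + j * q.
have su : st u = p - j * q.
  by rewrite /u raddfD/= stM sp sq st_ci mulrN cscalC.
have u1 : st u * u = 1.
  rewrite su /u mulrBl !mulrDr -e opprD addrA; congr (_ + _).
    by rewrite mulrA -cscalC -mulrA pq mulrA addrK.
  by rewrite [j * q * _]mulrA -[j * q * j]mulrA -(cscalC _ q) mulrA jj mulN1r mulNr opprK.
have nu : nrm u <= 1.
  have := nrm_star_mul u; rewrite u1 => e1; have := nrm1_le A; have := nrm_ge0 u; nra.
have -> : p = rscal 2^-1 * (u + st u).
  by rewrite su /u addrACA subrr addr0 rscal_half.
have := nrm_le_add u (st u).
by rewrite nrm_rscalM nrm_st ger0_norm// ler_pdivrMl// mulr1; lra.
Qed.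

Lemma norm_le_of_sum_sqr p q m : 0 < m -> sa p -> sa q -> GRing.comm p q ->
  p * p + q * q = rscal (m * m) -> nrm p <= m.
Proof.
move=> m0 sp sq pq e.
have := @norm_le1_of_sum_sqr (rscal m^-1 * p) (rscal m^-1 * q) (saZ _ sp) (saZ _ sq).
rewrite nrm_rscalM gtr0_norm ?invr_gt0// ler_pdivrMl// mulr1; apply.
  by apply: commrM; [exact: comm_rscal | apply/commr_sym/commrM; [exact: comm_rscal | exact/commr_sym]].
by rewrite !rscal_mulACA -mulrDr e -rmorphM/= (_ : _ * _ = 1) ?rmorph1//; field; lra.
Qed.

(** A square root [w] of [1 - b ^ 2] satisfies [w ^ 2 + b ^ 2 = 1], so that
    [norm_le1_of_sum_sqr] bounds [w]. *)
Lemma norm_1B_sqr b : sa b -> nrm b <= 1 -> nrm (1 - b * b) <= 1.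
Proof.
move=> sb b1.
have b2 : nrm (b * b) <= 1 by rewrite nrm_sqr// expr_le1// nrm_ge0.
have [w [sw ww _ bw]] := sqrt_1B (saM sb sb erefl) b2.
have w1 : nrm w <= 1.
  apply: (@norm_le1_of_sum_sqr w b) => //; last by rewrite ww subrK.
  by apply/commr_sym/bw; apply: commrM.
by rewrite -ww nrm_sqr// expr_le1// nrm_ge0.
Qed.

Lemma isqZ r a : 0 <= r -> isq a -> isq (rscal r * a).
Proof.
move=> r0 [b sb ->]; exists (rscal (Num.sqrt r) * b); first exact: saZ.
by rewrite rscal_mulACA -[_ * Num.sqrt r]expr2 sqr_sqrtr.
Qed.

Lemma isq_rscal r : 0 <= r -> isq (rscal r).
Proof.
by move=> r0; rewrite -[rscal r]mulr1; apply: isqZ => //; exists 1; rewrite ?mulr1//; exact: sa1.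
Qed.

(** Dividing by [m] brings [a] to the form [1 - x] with [x] in the unit ball.  The
    root [w] of [1 - x] is again within distance [1] of [1], so it has a root
    itself. *)
Lemma sqrt_of_norm a m : 0 < m -> sa a -> nrm (rscal m - a) <= m ->
  exists w, [/\ isq w, w * w = a & bicommutant a w].
Proof.
move=> m0 sa_a h; pose x := rscal m^-1 * (rscal m - a).
have sx : sa x by apply/saZ/saB/sa_a/sa_rscal.
have ex : 1 - x = rscal m^-1 * a.
  by rewrite /x mulrBr rscalV ?gt_eqF// opprB addrC subrK.
have x1 : nrm x <= 1.
  by rewrite nrm_rscalM gtr0_norm ?invr_gt0// ler_pdivrMl// mulr1.
have [w [sw ww w1 bw]] := sqrt_1B sx x1.
have [v [sv vv _ _]] := sqrt_1B (saB sa1 sw) w1.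
exists (rscal (Num.sqrt m) * w); split.
- by apply: isqZ; [exact: sqrtr_ge0 | exists v; rewrite ?vv// opprB addrC subrK].
- by rewrite rscal_mulACA -[_ * Num.sqrt m]expr2 sqr_sqrtr ?ltW// ww ex rscalMA mulfV ?gt_eqF// rmorph1 mul1r.
- move=> z hz; apply: commrM; first exact: comm_rscal.
  apply: bw; apply: commrM; first exact: comm_rscal.
  by apply: commrB => //; exact: comm_rscal.
Qed.

(** Together with [isq_of_norm], this describes the squares among the self-adjoint
    elements by a condition on the norm that is visibly stable under sums. *)
Lemma norm_of_isq a m : 0 < m -> isq a -> nrm a <= m -> nrm (rscal m - a) <= m.
Proof.
move=> m0 [b sb ->]; rewrite nrm_sqr// => hm.
pose c := rscal (Num.sqrt m)^-1 * b.
have cc : c * c = rscal m^-1 * (b * b).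
  by rewrite rscal_mulACA -[_ * (Num.sqrt m)^-1]expr2 exprVn sqr_sqrtr// ltW.
have sc : sa c by exact: saZ.
have c1 : nrm c <= 1.
  have : nrm (c * c) <= 1.
    by rewrite cc nrm_rscalM gtr0_norm ?invr_gt0// ler_pdivrMl// mulr1 nrm_sqr.
  by rewrite nrm_sqr// expr_le1// nrm_ge0.
have -> : rscal m - b * b = rscal m * (1 - c * c).
  by rewrite cc mulrBr mulr1 rscalMA mulfV ?gt_eqF// rmorph1 mul1r.
by rewrite nrm_rscalM gtr0_norm// ger_pMr// norm_1B_sqr.
Qed.

Lemma isq_of_norm a m : 0 < m -> sa a -> nrm (rscal m - a) <= m -> isq a.
Proof.
move=> m0 sa_a /(sqrt_of_norm m0 sa_a)[w [qw <- _]].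
by exists w => //; exact: isq_sa.
Qed.

Lemma sqrt_of_isq a : isq a -> exists w, [/\ isq w, w * w = a & bicommutant a w].
Proof.
move=> qa; have m0 : 0 < nrm a + 1 by rewrite ltr_wpDl ?nrm_ge0.
by apply: (sqrt_of_norm m0 (isq_sa qa)); apply: norm_of_isq => //; rewrite lerDl.
Qed.

Lemma isqD a b : isq a -> isq b -> isq (a + b).
Proof.
move=> qa qb.
have ma : 0 < nrm a + 1 by rewrite ltr_wpDl ?nrm_ge0.
have mb : 0 < nrm b + 1 by rewrite ltr_wpDl ?nrm_ge0.
apply: (@isq_of_norm _ (nrm a + 1 + (nrm b + 1))); first exact: addr_gt0.
  by apply: saD; exact: isq_sa.
rewrite rmorphD/= opprD addrACA (le_trans (nrm_le_add _ _))// lerD//.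
  by apply: norm_of_isq; rewrite ?lerDl.
by apply: norm_of_isq; rewrite ?lerDl.
Qed.

(** Roots [p] of [m - f] and [q] of [m + f] commute with each other and with [f], and
    [f ^ 2 + (p q) ^ 2 = m ^ 2]; the bound is then [norm_le_of_sum_sqr]. *)
Lemma norm_le_of_order f m : 0 < m -> sa f ->
  isq (rscal m - f) -> isq (rscal m + f) -> nrm f <= m.
Proof.
move=> m0 sf /sqrt_of_isq[p [qp pp bp]] /sqrt_of_isq[q [qq qqe bq]].
have fp : GRing.comm f p by apply/bp/commrB => //; exact: comm_rscal.
have fq : GRing.comm f q by apply/bq/commrD => //; exact: comm_rscal.
have pq : GRing.comm p q.
  by apply: bq; apply: commrD; [exact: comm_rscal | exact: commr_sym].
apply: (@norm_le_of_sum_sqr f (p * q)) => //.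
- by apply: saM => //; exact: isq_sa.
- exact: commrM.
rewrite comm_mulACA// pp qqe -comm_subr_sqr; last exact: rscalC.
by rewrite rmorphM/= addrC subrK.
Qed.

(** Invertibility as defined for C*-algebras, in terms of the ring structure. *)
Definition inv (x : B) := exists y, x * y = 1 /\ y * x = 1.

Lemma inv_comm x y w : x * y = 1 -> y * x = 1 -> GRing.comm w x -> GRing.comm w y.
Proof.
move=> xy yx wx; rewrite /GRing.comm -[w * y]mul1r -yx -!mulrA; congr (_ * _).
by rewrite mulrA -wx -mulrA xy mulr1.
Qed.

Lemma invM x y : inv x -> inv y -> inv (x * y).
Proof.
move=> [x' [xx x'x]] [y' [yy y'y]]; exists (y' * x'); split.
  by rewrite mulrA -(mulrA x) yy mulr1.
by rewrite mulrA -(mulrA y') x'x mulr1.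
Qed.

Lemma inv_mull x y : GRing.comm x y -> inv (x * y) -> inv x.
Proof.
move=> xy [w [h1 h2]]; exists (y * w); rewrite mulrA; split=> //.
have -> : y * w = w * y.
  apply: (inv_comm h1 h2); apply: commrM => //; exact: commr_sym.
by rewrite -mulrA -xy.
Qed.

Lemma invZ r x : r != 0 -> inv (rscal r * x) -> inv x.
Proof. by move=> r0; rewrite rscalC; apply: inv_mull; exact: comm_rscal. Qed.

(** For [m] above the norm of [a], the element [a + e] is [m + e] times [1 - x], where
    the norm of [x] is at most [m / (m + e)]. *)
Lemma inv_isqD a e : isq a -> 0 < e -> inv (a + rscal e).
Proof.
move=> qa e0; pose m := nrm a + 1.
have m0 : 0 < m by rewrite ltr_wpDl ?nrm_ge0.
have me : 0 < m + e by exact: addr_gt0.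
pose x := rscal (m + e)^-1 * (rscal m - a).
have ex : 1 - x = rscal (m + e)^-1 * (a + rscal e).
  rewrite /x -(rscalV (lt0r_neq0 me)) -mulrBr; congr (_ * _).
  by rewrite rmorphD/= opprB addrC addrA subrK addrC.
apply: (@invZ (m + e)^-1); first by rewrite invr_eq0 gt_eqF.
rewrite -ex; apply: neumann; rewrite nrm_rscalM gtr0_norm ?invr_gt0// ltr_pdivrMl// mulr1.
by apply: le_lt_trans (norm_of_isq m0 qa _) _; rewrite ?lerDl ?ltrDl.
Qed.

(** This takes the place of the spectral radius formula.  Write [m] for [nrm b ^ 2].
    The element [d = m - b ^ 2] has a square root [s].  If [d] had an inverse [y],
    then [d - e = s (1 - e y) s] would still be a square for small [e], which by
    [norm_le_of_order] would bound the norm of [b ^ 2] by [m - e]. *)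
Lemma not_inv_norm_sqr b : sa b -> b != 0 -> ~ inv (rscal (nrm b ^+ 2) - b * b).
Proof.
move=> sb b0; set m := nrm b ^+ 2; set d := _ - _; move=> [y [dy yd]].
have m0 : 0 < m by rewrite exprn_gt0// nrm_gt0.
have sbb : sa (b * b) by exact: saM.
have qd : isq d.
  apply: (isq_of_norm m0); first exact/saB/sbb/sa_rscal.
  by rewrite opprB addrC subrK nrm_sqr.
have sy : sa y.
  have h1 : st y * d = 1 by rewrite -(isq_sa qd) -stM dy st1.
  by rewrite /sa -[LHS]mulr1 -dy mulrA h1 mul1r.
have [s [qs ss bs]] := sqrt_of_isq qd.
(* small enough for [1 - e y] to have a root, and for [m - e] to be positive *)
pose e := Num.min (nrm y + 1)^-1 (m / 2).
have y0 : 0 < nrm y + 1 by rewrite ltr_wpDl ?nrm_ge0.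
have e0 : 0 < e by rewrite lt_min invr_gt0 y0 divr_gt0.
have ey : nrm (rscal e * y) <= 1.
  rewrite nrm_rscalM gtr0_norm//.
  have : e * (nrm y + 1) <= 1 by rewrite -ler_pdivlMr// div1r ge_min lexx.
  have := nrm_ge0 y; nra.
have em : e <= m / 2 by rewrite ge_min lexx orbT.
have [q [sq qqe _ bq]] := sqrt_1B (saZ e sy) ey.
have sy' : GRing.comm s y.
  by apply: (inv_comm dy yd); rewrite -ss; apply: commrM.
have sqC : GRing.comm s q by apply: bq; apply: commrM => //; exact: comm_rscal.
have q1 : isq (rscal (m - e) - b * b).
  exists (s * q); first by apply: saM => //; exact: isq_sa.
  rewrite comm_mulACA// ss qqe mulrBr mulr1 mulrA -rscalC -mulrA dy mulr1.
  by rewrite rmorphB/= /d addrAC.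
have q2 : isq (rscal (m - e) + b * b).
  by apply: isqD; [apply: isq_rscal; lra | exists b].
have := norm_le_of_order (_ : 0 < m - e) sbb q1 q2.
by rewrite nrm_sqr// -/m; lra.
Qed.

(** Squares have nonnegative spectrum: for [k = u + i v] with [v] nonzero,
    [(a - u) ^ 2 + v ^ 2] is invertible and has the factor [a - k].  Conversely put
    [b = nrm a - a].  By [not_inv_norm_sqr], one of [nrm b - b] and [nrm b + b] is not
    invertible; the second one is, so [nrm a - nrm b] lies in the spectrum of [a],
    whence the norm of [b] is at most that of [a] and [isq_of_norm] applies. *)
Lemma positive_isq (a : B) : @positive_elts R A a <-> isq a.
Proof.
have csE k : a - k *: (1 : B) = a - cscal A k by [].
split=> [[sa_a ha]|qa]; last first.
  split=> [|k]; first exact: isq_sa.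
  rewrite /spectrum/= => hk; apply: contrapT => k0; apply: hk.
  change (inv (a - cscal A k)).
  case: k k0 => u v k0; have [v0|v0] := eqVneq v 0.
    have u0 : 0 < - u.
      by rewrite oppr_gt0 ltNge; apply/negP => u0; apply: k0; rewrite lecE/= v0 eqxx.
    by have := inv_isqD qa u0; rewrite rmorphN /rscal/= v0.
  have ek : cscal A (Complex u v) = rscal u + cscal A ('i%C : C) * rscal v.
    rewrite !rscalE -rmorphM -rmorphD; congr cscal; apply/eqP.
    by rewrite eq_complex/=; apply/andP; split; apply/eqP; ring.
  pose j := cscal A ('i%C : C) * rscal v.
  have ja (x : B) : GRing.comm j x.
    by apply/commr_sym/commrM; rewrite /GRing.comm ?cscalC ?rscalC.
  apply: (@inv_mull _ (a - rscal u + j)).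
    apply: commrD; last exact/commr_sym/ja.
    apply: commrB; last exact: comm_rscal.
    by apply/commr_sym/commrB => //; rewrite /GRing.comm cscalC.
  rewrite ek opprD addrA -comm_subr_sqr; last exact/commr_sym/ja.
  have -> : j * j = - rscal (v * v).
    rewrite /j comm_mulACA; last exact: cscalC.
    by rewrite cscal_ii mulN1r rmorphM.
  rewrite opprK; apply: inv_isqD.
    have sau : sa (a - rscal u) by apply/saB/sa_rscal/isq_sa.
    by exists (a - rscal u).
  by rewrite -expr2 exprn_even_gt0.
have [->|a0] := eqVneq a 0; first by rewrite -(rmorph0 rscal); apply: isq_rscal.
set p := nrm a; have p0 : 0 < p by exact: nrm_gt0.
apply: (isq_of_norm p0 sa_a); set b := rscal p - a; set r := nrm b.
have [b0|b0] := eqVneq b 0; first by rewrite /r b0 nrm0 ltW.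
have sb : sa b by apply/saB/sa_a/sa_rscal.
have h1 : inv (rscal r + b).
  rewrite addrC; apply: inv_isqD; last exact: nrm_gt0.
  by apply: (isq_of_norm p0 sb); rewrite opprB addrC subrK.
have h2 : ~ inv (a - rscal (p - r)).
  move=> h2; apply: (not_inv_norm_sqr sb b0).
  rewrite expr2 rmorphM/= comm_subr_sqr; last exact: rscalC.
  apply: invM => //; rewrite -/r (_ : rscal r - b = a - rscal (p - r))//.
  by rewrite rmorphB/= /b !opprB addrCA.
by have := ha _ h2; rewrite lecR subr_ge0.
Qed.

End Positivity.

(** * Orderings of a commutative algebra *)

(** Commutativity is a parameter of the type, so that the commutative ring
    structure is found from the type alone. *)
Definition com_alg (R : realType) (A : cstarAlgType R) (cA : commutative_alg A) : Type := alg A.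

Section ComRing.
Context (R : realType) (A : cstarAlgType R) (cA : commutative_alg A).
HB.instance Definition _ := GRing.PzRing.on (com_alg cA).
HB.instance Definition _ := GRing.PzRing_hasCommutativeMul.Build (com_alg cA) cA.
End ComRing.

Section Orderings.
Context (R : realType) (A : cstarAlgType R) (cA : commutative_alg A).
Local Notation C := (Cplx R).
Local Notation B := (com_alg cA).
Implicit Types (x y z a b c q : B) (k : C) (r s t m e : R) (Q S : set B).

Definition com_rscal : R -> B := rscal A.
HB.instance Definition _ := GRing.RMorphism.copy com_rscal (rscal A : R -> alg A).
Local Notation rscal := com_rscal.
Local Notation isq := (@isq R A : set B).
Local Notation sa := (@sa R A : set B).
Local Notation nrm := (@nrm R A).
Local Notation st := (@st R A : B -> B).

(** Orderings play the part of maximal ideals: a maximal ordering is total, and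
    comparing elements with the real scalars yields a character. *)
Definition precone Q := [/\ isq `<=` Q, Q `<=` sa,
  forall x y, Q x -> Q y -> Q (x + y) & forall x y, Q x -> Q y -> Q (x * y)].

Definition ordering Q := precone Q /\ ~ Q (-1).

Lemma com_saM x y : sa x -> sa y -> sa (x * y).
Proof. by move=> sx sy; apply: (@saM R A x y) => //; exact: cA. Qed.

Lemma com_saZ r x : sa x -> sa (rscal r * x).
Proof. by move=> sx; exact (@saZ R A r x sx). Qed.

Lemma isq_precone : precone isq.
Proof.
split=> //; [exact: isq_sa | exact: isqD | move=> _ _ [a ha ->] [b hb ->]].
exists (a * b); first exact: com_saM.
by rewrite mulrACA.
Qed.

Definition adjoin Q b : set B := [set x | exists q, exists r : B, [/\ Q q, Q r & x = q + b * r]].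

Lemma precone_adjoin Q b : precone Q -> sa b -> precone (adjoin Q b).
Proof.
move=> [qQ sQ DQ MQ] sb; have Q0 : Q 0 by apply: qQ; exists 0; rewrite ?mulr0//; exact: raddf0.
split.
- by move=> x /qQ Qx; exists x, 0; split=> //; rewrite mulr0 addr0.
- move=> _ [q [r [/sQ sq /sQ sr ->]]]; apply: saD => //.
  exact: com_saM.
- move=> _ _ [q [r [Qq Qr ->]]] [q' [r' [Qq' Qr' ->]]].
  by exists (q + q'), (r + r'); split; [exact: DQ | exact: DQ | ring].
- move=> _ _ [q [r [Qq Qr ->]]] [q' [r' [Qq' Qr' ->]]].
  exists (q * q' + (b * b) * (r * r')), (q * r' + r * q'); split; last by ring.
    by apply: (DQ); apply: (MQ); [| |apply: qQ; exists b | exact: MQ].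
  by apply: (DQ); exact: MQ.
Qed.

Lemma adjoin_sub Q b : precone Q -> Q `<=` adjoin Q b.
Proof.
move=> [qQ _ _ _] x Qx; exists x, 0; rewrite mulr0 addr0; split=> //.
by apply: qQ; exists 0; rewrite ?mulr0//; exact: raddf0.
Qed.

Lemma adjoin_mem Q b : precone Q -> adjoin Q b b.
Proof.
move=> [qQ _ _ _]; exists 0, 1; rewrite mulr1 add0r; split=> //; apply: qQ.
  by exists 0; rewrite ?mulr0//; exact: raddf0.
by exists 1; rewrite ?mulr1//; exact: sa1.
Qed.

(** Zorn's lemma is applied to the sets whose union with [S] is an ordering, because
    these include the union of the empty chain. *)
Lemma maximal_ordering S : ordering S ->
  exists Q, [/\ ordering Q, S `<=` Q & forall Q', ordering Q' -> Q `<=` Q' -> Q' = Q].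
Proof.
move=> oS; pose P Q := ordering (Q `|` S).
have [|Q [PQ maxQ]] := @Zorn_bigcup B P.
  move=> F FP tF; have [->|/set0P[X0 FX0]] := eqVneq F set0.
    by rewrite /P bigcup_set0 set0U.
  have two X Y : F X -> F Y -> exists Z, [/\ F Z, X `<=` Z & Y `<=` Z].
    by move=> FX FY; have [h|h] := tF _ _ FX FY; [exists Y; split | exists X; split].
  have pick x : (\bigcup_(X in F) X `|` S) x -> exists2 X, F X & (X `|` S) x.
    by case=> [[X FX Xx]|Sx]; [exists X => //; left | exists X0 => //; right].
  have up X : F X -> X `|` S `<=` \bigcup_(X in F) X `|` S.
    by move=> FX x [Xx|Sx]; [left; exists X | right].
  have both x y : (\bigcup_(X in F) X `|` S) x -> (\bigcup_(X in F) X `|` S) y ->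
      exists Z, [/\ F Z, (Z `|` S) x & (Z `|` S) y].
    move=> /pick[X FX Xx] /pick[Y FY Yy]; have [Z [FZ XZ YZ]] := two _ _ FX FY.
    by exists Z; split=> //; [case: Xx => [/XZ|] h; [by left|by right] | case: Yy => [/YZ|] h; [by left|by right]].
  split; first split.
  - by move=> x qx; right; case: oS => -[+ _ _ _] _; apply.
  - by move=> x /pick[X /FP[[_ + _ _] _]]; apply.
  - move=> x y hx hy; have [Z [FZ Zx Zy]] := both _ _ hx hy; apply: (up _ FZ).
    by have [[_ _ + _] _] := FP _ FZ; apply.
  - move=> x y hx hy; have [Z [FZ Zx Zy]] := both _ _ hx hy; apply: (up _ FZ).
    by have [[_ _ _ +] _] := FP _ FZ; apply.
  - by move=> /pick[Z /FP[_ +]]; apply.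
exists (Q `|` S); split; [exact: PQ | by move=> x; right |].
move=> Q' oQ' sub; apply/seteqP; split=> // x Q'x; apply: contrapT => nx.
apply: (maxQ Q'); last first.
  by rewrite /P (_ : Q' `|` S = Q')//; apply/setUidPl => y Sy; apply: sub; right.
split; last by move=> h; apply: nx; left; exact: h.
by move=> y Qy; apply: sub; left.
Qed.

Section Total.
Variable Q : set B.
Hypothesis oQ : ordering Q.
Hypothesis maxQ : forall Q', ordering Q' -> Q `<=` Q' -> Q' = Q.

Let Qsq x : isq x -> Q x. Proof. by case: oQ => -[+ _ _ _] _; apply. Qed.
Let Qsa x : Q x -> sa x. Proof. by case: oQ => -[_ + _ _] _; apply. Qed.
Let QD x y : Q x -> Q y -> Q (x + y). Proof. by case: oQ => -[_ _ + _] _; apply. Qed.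
Let QM x y : Q x -> Q y -> Q (x * y). Proof. by case: oQ => -[_ _ _ +] _; apply. Qed.
Let QN1 : ~ Q (-1). Proof. by case: oQ. Qed.

(** If neither [b] nor [- b] belonged to [Q], both adjunctions would contain [-1], and
    multiplying [- b r = 1 + q] by [b r' = 1 + q'] would exhibit [-1] in [Q]. *)
Lemma ordering_total b : sa b -> Q b \/ Q (- b).
Proof.
move=> sb; have [pQ _] := oQ.
have ad c : sa c -> ~ Q c -> adjoin Q c (-1).
  move=> sc nc; apply: contrapT => nad; apply: nc.
  rewrite -(maxQ (conj (precone_adjoin pQ sc) nad) (@adjoin_sub _ _ pQ)).
  exact: adjoin_mem.
apply: contrapT => /not_orP[/(ad _ sb)[q [r [Qq Qr e]]] /(ad _ (saN sb))[q' [r' [Qq' Qr' e']]]].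
apply: QN1; rewrite (_ : -1 = q + q' + q * q' + b * b * (r * r')).
  apply: QD; last by apply: QM; [apply: Qsq; exists b | exact: QM].
  by apply: QD; [exact: QD | exact: QM].
have h : - (b * r) = 1 + q by rewrite -[1]opprK e opprD addrAC addNr add0r.
have h' : b * r' = 1 + q' by rewrite -[1]opprK e' mulNr opprB addrNK.
transitivity ((1 + q) * (1 + q') - 1 + (b * r) * (b * r')); last by ring.
by rewrite h' -h; ring.
Qed.

Lemma Q_rscal r : 0 <= r -> Q (rscal r).
Proof. by move=> r0; apply: Qsq; exact: isq_rscal. Qed.

Lemma Q_rscal_ge0 r : Q (rscal r) -> 0 <= r.
Proof.
move=> Qr; rewrite leNgt; apply/negP => r0; apply: QN1.
rewrite (_ : -1 = rscal (- r^-1) * rscal r); first by apply: QM => //; apply: Q_rscal; rewrite oppr_ge0 invr_le0 ltW.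
by rewrite -rmorphM/= mulNr mulVf ?lt_eqF// rmorphN1.
Qed.

Lemma Q_norm b : sa b -> Q (rscal (nrm b) + b).
Proof.
move=> sb; have [b0|b0] := eqVneq b 0.
  by rewrite b0 addr0 nrm0; exact: Q_rscal.
apply/Qsq/(isq_of_norm (nrm_gt0 b0)); first exact/saD/sb/sa_rscal.
by rewrite opprD addrA subrr add0r nrmN.
Qed.

Definition cut b := [set t : R | Q (b - rscal t)].
(** The value at [b] of the character that belongs to [Q], as a Dedekind cut. *)
Definition val_at b := sup (cut b).

Lemma cut_ub b t : sa b -> Q (b - rscal t) -> t <= nrm b.
Proof.
move=> sb Qb; rewrite -subr_ge0; apply: Q_rscal_ge0.
rewrite (_ : rscal _ = rscal (nrm (- b)) + - b + (b - rscal t)).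
  by apply: QD => //; apply: Q_norm; exact: saN.
by rewrite nrmN rmorphB/=; ring.
Qed.

Lemma has_sup_cut b : sa b -> has_sup (cut b).
Proof.
move=> sb; split; last by exists (nrm b) => t /(cut_ub sb).
by exists (- nrm b); rewrite /cut/= rmorphN opprK addrC; exact: Q_norm.
Qed.

Lemma Q_lt_val b t : sa b -> t < val_at b -> Q (b - rscal t).
Proof.
move=> sb tb; have e0 : 0 < val_at b - t by rewrite subr_gt0.
have [s Qs] := sup_adherent e0 (has_sup_cut sb); rewrite -/(val_at b) => hs.
rewrite (_ : b - rscal t = (b - rscal s) + rscal (s - t)); last by rewrite rmorphB/=; ring.
by apply: QD => //; apply: Q_rscal; lra.
Qed.

Lemma Q_gt_val b t : sa b -> val_at b < t -> Q (rscal t - b).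
Proof.
move=> sb tb; have [|//] := ordering_total (saB sb (sa_rscal A t)).
  move=> Qt; suff : t <= val_at b by rewrite leNgt tb.
  by apply: ub_le_sup; [case: (has_sup_cut sb) | exact: Qt].
by rewrite opprB.
Qed.

(** The defining property of the cut, in the symmetric form from which additivity and
    homogeneity are read off. *)
Lemma val_unique b v : sa b -> (forall t, t < v -> Q (b - rscal t)) ->
  (forall t, v < t -> Q (rscal t - b)) -> val_at b = v.
Proof.
move=> sb h1 h2; apply/le_anti/andP; split; rewrite leNgt; apply/negP => lt.
  (* two points strictly between [v] and the value, in the wrong order for [Q] *)
  pose s := v + (val_at b - v) / 3; pose s' := v + 2 * (val_at b - v) / 3.
  have : 0 <= s - s'.
    apply: Q_rscal_ge0; rewrite (_ : rscal _ = (rscal s - b) + (b - rscal s')).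
      by apply: QD; [apply: h2; rewrite /s; lra | apply: Q_lt_val => //; rewrite /s'; lra].
    by rewrite rmorphB/=; ring.
  by rewrite /s/s'; lra.
have : (val_at b + v) / 2 <= val_at b.
  by apply: ub_le_sup; [case: (has_sup_cut sb) | apply: h1; lra].
lra.
Qed.

Lemma valD b c : sa b -> sa c -> val_at (b + c) = val_at b + val_at c.
Proof.
move=> sb sc; apply: val_unique => [|t ht|t ht]; first exact: saD.
  rewrite (_ : _ - _ = (b - rscal (val_at b - (val_at b + val_at c - t) / 2)) +
                       (c - rscal (val_at c - (val_at b + val_at c - t) / 2))).
    by apply: QD; apply: Q_lt_val => //; lra.
  by rewrite addrACA -opprD -rmorphD/=; congr (_ - rscal _); lra.
rewrite (_ : _ - _ = (rscal (val_at b + (t - val_at b - val_at c) / 2) - b) +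
                     (rscal (val_at c + (t - val_at b - val_at c) / 2) - c)).
  by apply: QD; apply: Q_gt_val => //; lra.
by rewrite addrACA -opprD -rmorphD/=; congr (rscal _ - _); lra.
Qed.

Lemma val_rscal r : val_at (rscal r) = r.
Proof.
by apply: val_unique => [|t ht|t ht]; [exact: sa_rscal| |]; rewrite -rmorphB/=; apply: Q_rscal; lra.
Qed.

Lemma valN b : sa b -> val_at (- b) = - val_at b.
Proof.
move=> sb; have := valD sb (saN sb); rewrite subrr -(rmorph0 rscal) val_rscal; lra.
Qed.

Lemma valZ_gt0 r b : 0 < r -> sa b -> val_at (rscal r * b) = r * val_at b.
Proof.
move=> r0 sb; have rV : rscal r * rscal r^-1 = 1 by rewrite -rmorphM/= mulfV ?gt_eqF// rmorph1.
apply: val_unique => [|t ht|t ht]; first exact: com_saZ.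
  rewrite (_ : _ - _ = rscal r * (b - rscal (r^-1 * t))).
    by apply: QM; [exact/Q_rscal/ltW | apply: Q_lt_val; rewrite // ltr_pdivrMl].
  by rewrite rmorphM/= mulrBr mulrA rV mul1r.
rewrite (_ : _ - _ = rscal r * (rscal (r^-1 * t) - b)).
  by apply: QM; [exact/Q_rscal/ltW | apply: Q_gt_val; rewrite // ltr_pdivlMl].
by rewrite rmorphM/= mulrBr mulrA rV mul1r.
Qed.

Lemma valZ r b : sa b -> val_at (rscal r * b) = r * val_at b.
Proof.
move=> sb; have [r0|r0|->] := ltgtP r 0; last 1 first.
- by rewrite rmorph0 !mul0r -(rmorph0 rscal) val_rscal.
- rewrite -[r]opprK rmorphN/= !mulNr valN ?valZ_gt0 ?oppr_gt0//; last exact: com_saZ.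
  by rewrite mulNr.
- exact: valZ_gt0.
Qed.

Lemma val_ge0 b : Q b -> 0 <= val_at b.
Proof.
move=> Qb; apply: ub_le_sup; first by case: (has_sup_cut (Qsa Qb)).
by rewrite /cut/= rmorph0 subr0.
Qed.

(** For [t > 0], the element [t - b ^ 2] is the product of [sqrt t - b] and
    [sqrt t + b], which both belong to [Q]. *)
Lemma val_sqr0 b : sa b -> val_at b = 0 -> val_at (b * b) = 0.
Proof.
move=> sb b0; have sbb : sa (b * b) by exact: com_saM.
apply: val_unique => // t t0.
  rewrite -rmorphN/=; apply: QD; first by apply: Qsq; exists b.
  by apply: Q_rscal; lra.
rewrite (_ : _ - _ = (rscal (Num.sqrt t) - b) * (b - rscal (- Num.sqrt t))).
  by apply: QM; [apply: Q_gt_val | apply: Q_lt_val]; rewrite ?b0 ?oppr_lt0 ?sqrtr_gt0.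
have {1}-> : t = Num.sqrt t ^+ 2 by rewrite sqr_sqrtr ?ltW.
by rewrite rmorphN/=; ring.
Qed.

Lemma val_sqr b : sa b -> val_at (b * b) = val_at b ^+ 2.
Proof.
move=> sb; set v := val_at b; pose b0 := b - rscal v.
have sv : sa (rscal v) by exact: sa_rscal.
have s0 : sa b0 by exact: saB.
have v0 : val_at b0 = 0 by rewrite valD// ?valN// ?val_rscal ?subrr//; exact: saN.
have s00 : sa (b0 * b0) by exact: com_saM.
have -> : b * b = b0 * b0 + (rscal (2 * v) * b0 + rscal (v ^+ 2)) by rewrite /b0; ring.
rewrite valD ?valD ?valZ ?val_rscal ?val_sqr0 ?v0//; first ring.
- exact: com_saZ.
- exact: sa_rscal.
- by apply: saD; [exact: com_saZ | exact: sa_rscal].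
Qed.

(** Polarization: [2 b c = (b + c) ^ 2 - b ^ 2 - c ^ 2]. *)
Lemma valM b c : sa b -> sa c -> val_at (b * c) = val_at b * val_at c.
Proof.
move=> sb sc.
have sbc : sa (b * c) by exact: com_saM.
have sD : sa (b + c) by exact: saD.
have sbb : sa (b * b) by exact: com_saM.
have scc : sa (c * c) by exact: com_saM.
have := val_sqr sD; rewrite (_ : (b + c) * (b + c) = b * b + (rscal 2 * (b * c) + c * c)); last by ring.
rewrite valD ?valD ?valZ ?val_sqr//; first by lra.
- exact: com_saZ.
- by apply: saD => //; exact: com_saZ.
Qed.

End Total.
End Orderings.

(** * Characters *)

Record is_char (R : realType) (A : cstarAlgType R) (chi : alg A -> Cplx R) : Prop := {
  charD : forall x y, chi (x + y) = chi x + chi y ;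
  charZ : forall k x, chi (k *: x) = k * chi x ;
  charM : forall x y, chi (x * y) = chi x * chi y ;
  char_st : forall x, chi (st x) = Num.conj (chi x) ;
  char1 : chi 1 = 1
}.

Section CharFacts.
Context (R : realType) (A : cstarAlgType R) (chi : alg A -> Cplx R).
Hypothesis chiP : is_char chi.
Local Notation B := (alg A).
Implicit Types (x y a : B) (r : R).

Lemma char_cscal k : chi (cscal A k) = k.
Proof. by rewrite /cscal (charZ chiP) (char1 chiP) mulr1. Qed.

Lemma charN x : chi (- x) = - chi x.
Proof. by rewrite -scaleN1r (charZ chiP) mulN1r. Qed.

Lemma charB x y : chi (x - y) = chi x - chi y.
Proof. by rewrite (charD chiP) charN. Qed.

Lemma char_inv_neq0 x : inv x -> chi x != 0.
Proof.
move=> [y [xy _]]; apply/eqP => x0.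
by have /eqP := char1 chiP; rewrite -xy (charM chiP) x0 mul0r eq_sym oner_eq0.
Qed.

(** If [|chi x| ^ 2] exceeded the norm of [x^* x], then [|chi x| ^ 2 - x^* x] would be
    an invertible element in the kernel of [chi]. *)
Lemma char_bound x : `|chi x| <= (nrm x)%:C%C.
Proof.
pose v := complex.Re `|chi x|.
have vE : `|chi x| = (v%:C)%C.
  have := normr_ge0 (chi x); rewrite /v; case: (`|chi x|) => a b.
  by rewrite lecE/= => /andP[/eqP-> _].
have v0 : 0 <= v by have := normr_ge0 (chi x); rewrite vE lecR.
rewrite vE lecR leNgt; apply/negP => xv.
have vp : 0 < v by rewrite (le_lt_trans (nrm_ge0 x)).
pose y := rscal A (v ^+ 2)^-1 * (st x * x).
have /neumann iy : nrm y < 1.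
  rewrite nrm_rscalM nrm_star_mul gtr0_norm ?invr_gt0 ?exprn_gt0// ltr_pdivrMl ?exprn_gt0// mulr1.
  by rewrite ltr_pXn2r// nnegrE nrm_ge0.
have /eqP := char_inv_neq0 iy; apply.
rewrite charB (char1 chiP) /y (charM chiP) char_cscal (charM chiP) (char_st chiP).
rewrite mulrC [Num.conj _ * _]mulrC -normCK vE -rmorphXn -rmorphM/= mulfV ?subrr//.
by rewrite sqrf_eq0 gt_eqF.
Qed.
End CharFacts.

Section Char.
Context (R : realType) (A : cstarAlgType R) (cA : commutative_alg A).
Local Notation C := (Cplx R).
Local Notation B := (com_alg cA).
Implicit Types (x y z a b c q : B) (k : C) (r s t m e : R) (Q S : set B).
Local Notation rscal := (com_rscal cA).
Local Notation isq := (@isq R A : set B).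
Local Notation sa := (@sa R A : set B).
Local Notation nrm := (@nrm R A).
Definition com_st : B -> B := @st R A.
HB.instance Definition _ := GRing.Additive.copy com_st (@st R A : alg A -> alg A).
Local Notation st := com_st.

Definition com_cscal : C -> B := cscal A.
HB.instance Definition _ := GRing.RMorphism.copy com_cscal (cscal A : C -> alg A).

Let j : B := com_cscal ('i%C : C).
Let jj : j * j = -1. Proof. exact: cscal_ii. Qed.
Let stj : st j = - j. Proof. exact: (st_ci A). Qed.
Let com_stM x y : st (x * y) = st x * st y.
Proof. by rewrite mulrC; exact: (@stM R A). Qed.

Lemma com_cscalE r s : com_cscal (Complex r s) = rscal r + j * rscal s.
Proof.
rewrite -[rscal r]/(com_cscal (r%:C%C)) -[rscal s]/(com_cscal (s%:C%C)) /j -rmorphM/= -rmorphD/=; congr com_cscal.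
by apply/eqP; rewrite eq_complex/=; apply/andP; split; apply/eqP; ring.
Qed.

Definition com_re_part x : B := rscal 2^-1 * (x + st x).
Definition com_im_part x : B := rscal 2^-1 * (- j * (x - st x)).

Let half : rscal 2^-1 + rscal 2^-1 = 1.
Proof. by rewrite -rmorphD/= -[RHS](rmorph1 rscal); congr rscal; lra. Qed.

Lemma com_re_partE a b : sa a -> sa b -> com_re_part (a + j * b) = a.
Proof.
move=> sa_a sb; rewrite /com_re_part raddfD/= com_stM stj [st a]sa_a [st b]sb.
rewrite -[RHS]mul1r -half; ring.
Qed.
Lemma com_im_partE a b : sa a -> sa b -> com_im_part (a + j * b) = b.
Proof.
move=> sa_a sb; rewrite /com_im_part raddfD/= com_stM stj [st a]sa_a [st b]sb.
rewrite -[RHS]mul1r -half; ring: jj.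
Qed.

Let decomp x : exists a b, [/\ sa a, sa b & x = a + j * b].
Proof.
by exists (com_re_part x), (com_im_part x); split; [exact: sa_re_part | exact: sa_im_part | exact: re_im_partE].
Qed.

Section Extend.
Variable psi : B -> R.
Hypothesis psiD : forall a b, sa a -> sa b -> psi (a + b) = psi a + psi b.
Hypothesis psiM : forall a b, sa a -> sa b -> psi (a * b) = psi a * psi b.
Hypothesis psi_rscal : forall r, psi (rscal r) = r.

(** The complex-linear extension of a real character of the self-adjoint part. *)
Definition complexify x : C := Complex (psi (com_re_part x)) (psi (com_im_part x)).

Let complexifyE a b : sa a -> sa b -> complexify (a + j * b) = Complex (psi a) (psi b).
Proof. by move=> h1 h2; rewrite /complexify com_re_partE// com_im_partE. Qed.

Let psiN a : sa a -> psi (- a) = - psi a.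
Proof.
move=> h; have := psiD h (saN h); rewrite subrr -(rmorph0 rscal) psi_rscal; lra.
Qed.

Lemma complexify_real a : sa a -> complexify a = (psi a)%:C%C.
Proof.
move=> h; rewrite -[in LHS](addr0 a) -(mulr0 j) -[X in j * X](rmorph0 rscal) complexifyE//; last exact: sa_rscal.
by rewrite psi_rscal.
Qed.

Lemma complexify_is_char : is_char (complexify : alg A -> C).
Proof.
have cD x y : complexify (x + y) = complexify x + complexify y.
  have [a [b [sa_a sb ->]]] := decomp x; have [c [d [sc sd ->]]] := decomp y.
  rewrite (_ : _ + _ = a + c + j * (b + d)); last by ring.
  rewrite !complexifyE//; [|exact: saD..].
  by rewrite !psiD.
have cM x y : complexify (x * y) = complexify x * complexify y.
  have [a [b [sa_a sb ->]]] := decomp x; have [c [d [sc sd ->]]] := decomp y.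
  rewrite (_ : _ * _ = (a * c - b * d) + j * (a * d + b * c)); last by ring: jj.
  have [ac ad bc bd] := And4 (com_saM sa_a sc) (com_saM sa_a sd) (com_saM sb sc) (com_saM sb sd).
  rewrite !complexifyE//; [|exact: saB|exact: saD].
  rewrite (psiD ac (saN bd)) (psiD ad bc) (psiN bd).
  by rewrite (psiM sa_a sc) (psiM sa_a sd) (psiM sb sc) (psiM sb sd).
have cS x : complexify (st x) = Num.conj (complexify x).
  have [a [b [sa_a sb ->]]] := decomp x.
  rewrite raddfD/= com_stM stj [st a]sa_a [st b]sb mulNr -mulrN.
  by rewrite !complexifyE ?psiN//; exact: saN.
have cC k : complexify (com_cscal k) = k.
  by case: k => u v; rewrite com_cscalE complexifyE ?psi_rscal//; exact: sa_rscal.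
split=> //.
  by move=> k x; rewrite -{2}(cC k) -[LHS]/(complexify (k *: (x : alg A))) scaleE; exact: cM.
by rewrite -[RHS](cC 1); congr complexify; rewrite rmorph1.
Qed.
End Extend.

(** Write [m] for [nrm a ^ 2].  The cone obtained from the squares by adjoining
    [a ^ 2 - m] does not contain [-1]: otherwise [(m - a ^ 2) r = 1 + q] with a square
    [q], and [m - a ^ 2] would be invertible, against [not_inv_norm_sqr].  A maximal
    ordering that contains this cone gives a character with [chi a ^ 2 >= m]. *)
Lemma exists_char a : sa a -> a != 0 ->
  exists2 chi : alg A -> C, is_char chi & chi a ^+ 2 = (nrm a ^+ 2)%:C%C.
Proof.
move=> sa_a a0; set m := nrm a ^+ 2; pose d := a * a - rscal m.
have saa : sa (a * a) by exact: com_saM.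
have sd : sa d by apply: saB => //; exact: sa_rscal.
have [|Q [oQ sQ maxQ]] := @maximal_ordering R A cA (adjoin isq d).
  split; first exact/precone_adjoin/sd/isq_precone.
  move=> [q [r [qq qr e]]]; apply: (not_inv_norm_sqr sa_a a0).
  apply: (@inv_mull R A _ r); first exact: cA.
  have := inv_isqD qq ltr01; congr inv.
  change (q + rscal 1 = (rscal m - a * a) * r :> B).
  rewrite rmorph1 -[1]opprK e /d; ring.

pose psi := val_at Q; exists (complexify psi).
  apply: complexify_is_char.
  - exact: (valD oQ maxQ).
  - exact: (valM oQ maxQ).
  - exact: (val_rscal oQ).
rewrite complexify_real//; [|exact: (val_rscal oQ)|..].
rewrite -rmorphXn/=; congr (_%:C%C); apply/le_anti/andP; split.
  rewrite -(val_sqr oQ maxQ)// /m -nrm_sqr//; apply: ge_sup; first by case: (has_sup_cut oQ saa).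
  by move=> t; exact: (cut_ub oQ).
have := val_ge0 oQ (sQ _ (adjoin_mem d (isq_precone cA))).
rewrite (valD oQ maxQ)// ?(valN oQ maxQ) ?(val_rscal oQ) ?(val_sqr oQ maxQ)//.
- by rewrite subr_ge0.
- exact: sa_rscal.
- by apply: saN; exact: sa_rscal.
Qed.

End Char.

(** * Openness of the squaring map forces real rank zero and commutativity *)

Section Openness.
Context (R : realType) (A : cstarAlgType R).
Local Notation C := (Cplx R).
Local Notation B := (alg A).
Implicit Types (x y z a b c s w : B) (r t m e d : R).
Local Notation rscal := (rscal A).

(** Nearness in the cone of positive elements, with positivity expressed by
    squares. *)
Definition square_open_at x := forall e, 0 < e -> exists2 d, 0 < d &
  forall a, isq a -> nrm (x * x - a) < d ->
  exists y, [/\ sa y, y * y = a & nrm (x - y) < e].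

Lemma square_openP :
  open_map_on (@self_adjoint R A) (@positive_elts R A) (@square R A) <->
  forall x, sa x -> square_open_at x.
Proof.
split=> [H x sx e e0|H U [V oV ->]].
  pose V : set A := (ball (x : A) (e%:C%C : C))^°.
  have e0' : 0 < (e%:C%C : C) by rewrite ltcR.
  have [|W oW eW] := H (V `&` @self_adjoint R A).
    by exists V => //; exact: open_interior.
  have : ((@square R A) @` (V `&` @self_adjoint R A)) (x * x).
    by exists x => //; split=> //; exact: nbhsx_ballx.
  rewrite eW => -[Wx _]; have := open_nbhs_nbhs (conj oW Wx).
  move=> /nbhs_ballP[d' /= /Cplx_gt0[d d0 ->] dW]; exists d => // a qa ha.
  have : (W `&` @positive_elts R A) a.
    by split; [apply: dW; apply/nrm_ballP | apply/positive_isq].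
  rewrite -eW => -[y [Vy sy] <-]; exists y; split=> //.
  by apply/nrm_ballP; exact: interior_subset Vy.
pose good (x : B) (d : R) := [/\ 0 < d, V x, sa x & forall a, isq a -> nrm (x * x - a) < d ->
  exists y, [/\ sa y, y * y = a & V y]].
pose W : set A := [set a | exists x d, good x d /\ nrm (x * x - a) < d].
exists W.
  rewrite openE => a [x [d [gx ha]]]; apply/nbhs_ballP.
  exists ((d - nrm (x * x - a))%:C%C : C) => /=; first by rewrite ltcR subr_gt0.
  move=> b /nrm_ballP ab; exists x, d; split=> //.
  have := nrm_le_add (x * x - a) (a - b); rewrite addrA subrK; lra.
apply/seteqP; split=> [_ [x [Vx sx] <-]|a [[x [d [[d0 Vx sx gx] ha]]] pa]].
  split; last by apply/positive_isq; exists x.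
  have /nbhs_ballP[e' /= /Cplx_gt0[e e0 ->] eV] := open_nbhs_nbhs (conj oV Vx).
  have [d d0 hd] := H x sx e e0.
  exists x, d; split; last by rewrite subrr nrm0.
  split=> // a qa /(hd _ qa)[y [sy ya xy]].
  by exists y; split=> //; apply: eV; exact/nrm_ballP.
have [y [sy ya Vy]] := gx a (proj1 (positive_isq a) pa) ha.
by exists y.
Qed.

Lemma real_rank0P : real_rank_eq A 0 <-> forall x, sa x -> forall e, 0 < e ->
  exists z, [/\ sa z, inv z & nrm (x - z) < e].
Proof.
split=> [[H _] x sx e e0|H].
  have [y [sy iy]] := H (fun=> x) (fun=> sx) e e0.
  rewrite big_ord1 nrmE ltcR => hy; exists (y ord0); split=> //; first exact: sy.
  by move: iy; rewrite big_ord1; apply: (@inv_mull R A).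
split=> // x sx e e0; have [z [sz iz hz]] := H (x ord0) (sx _) e e0.
exists (fun=> z); split=> //; first by rewrite big_ord1; exact: (@invM R A).
by rewrite big_ord1 nrmE ltcR.
Qed.

(** The square of [x] plus a small positive constant is invertible, and so are its
    square roots, one of which is near [x]. *)
Lemma open_real_rank0 : (forall x, sa x -> square_open_at x) -> real_rank_eq A 0.
Proof.
move=> H; apply/real_rank0P => x sx e e0; have [d d0 hd] := H x sx e e0.
have qx : isq (x * x) by exists x.
have d2 : 0 < d / 2 by rewrite divr_gt0.
have [||y [sy yy xy]] := hd (x * x + rscal (d / 2)).
- by apply: isqD => //; apply: isq_rscal; rewrite ltW.
- rewrite opprD addrA subrr add0r nrmN; apply: le_lt_trans (nrm_rscal_le _ _) _.
  by rewrite gtr0_norm//; lra.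
exists y; split=> //; apply: (@inv_mull R A y y) => //.
by rewrite yy; exact: inv_isqD.
Qed.

(** In this form a quantity is shown to vanish by letting an error tend to [0]. *)
Lemma small_eq0 r m : 0 <= r -> (forall e, 0 < e -> r <= e * m) -> r = 0.
Proof.
move=> r0 h; apply/le_anti; rewrite r0 andbT leNgt; apply/negP => rp.
have m0 : 0 < m by have := h 1 ltr01; lra.
have := h (r / (2 * m)); rewrite divr_gt0 ?mulr_gt0// => /(_ isT).
have -> : r / (2 * m) * m = r / 2 by field; lra.
lra.
Qed.

Lemma nrm_commutator_near x y b e : GRing.comm y b -> nrm (x - y) < e ->
  nrm (x * b - b * x) <= e * (2 * nrm b).
Proof.
move=> yb xy; have -> : x * b - b * x = (x - y) * b - b * (x - y).
  by rewrite mulrBl mulrBr yb opprB addrA subrK.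
apply: le_trans (nrm_le_sub _ _) _.
have := nrm_le_mul (x - y) b; have := nrm_le_mul b (x - y); have := nrm_ge0 b; nra.
Qed.

Lemma comm_of_approx x b :
  (forall e, 0 < e -> exists2 y, GRing.comm y b & nrm (x - y) < e) -> GRing.comm x b.
Proof.
move=> h; apply/eqP; rewrite -subr_eq0 -nrm_eq0; apply/eqP.
apply: (@small_eq0 _ (2 * nrm b)); first exact: nrm_ge0.
by move=> e /h[y yb xy]; exact: nrm_commutator_near yb xy.
Qed.

Lemma comm_of_sa y : (forall b, sa b -> GRing.comm y b) -> forall x, GRing.comm y x.
Proof.
move=> h x; rewrite (re_im_partE x).
apply: commrD; first exact/h/sa_re_part.
by apply: commrM; [rewrite /GRing.comm cscalC | exact/h/sa_im_part].
Qed.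

(** For self-adjoint [b] and small [t > 0], the positive element [1 + t b] is near
    [s ^ 2 = 1], so it has a square root near [s].  The root commutes with its square,
    hence with [b]; so [s] is a limit of elements that commute with [b]. *)
Lemma open_symmetry_central s : square_open_at s -> s * s = 1 ->
  forall x, GRing.comm s x.
Proof.
move=> H ss; apply: comm_of_sa => b sb; apply: comm_of_approx => e e0.
have [d d0 hd] := H e e0; have b0 : 0 < nrm b + 1 by rewrite ltr_wpDl ?nrm_ge0.
pose t := Num.min d 1 / (2 * (nrm b + 1)).
have t0 : 0 < t by rewrite divr_gt0 ?mulr_gt0// lt_min d0 ltr01.
have tb : nrm (rscal t * b) <= Num.min d 1 / 2.
  rewrite nrm_rscalM gtr0_norm//.
  have : t * (nrm b + 1) = Num.min d 1 / 2 by rewrite /t; field; rewrite gt_eqF.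
  by move: t0; clear; lra.
have m0 : 0 < Num.min d 1 by rewrite lt_min d0 ltr01.
have md : Num.min d 1 <= d by rewrite ge_min lexx.
have m1 : Num.min d 1 <= 1 by rewrite ge_min lexx orbT.
have [||y [sy yy xy]] := hd (1 + rscal t * b).
- apply: (@isq_of_norm _ _ _ 1) => //; first by apply: saD; [exact: sa1 | exact: saZ].
  by rewrite rmorph1 opprD addrA subrr add0r nrmN; lra.
- by rewrite ss opprD addrA subrr add0r nrmN; lra.
exists y => //.
have -> : b = rscal t^-1 * (y * y - 1).
  by rewrite yy addrAC subrr add0r rscalMA mulVf ?gt_eqF// rmorph1 mul1r.
apply: commrM; first exact: comm_rscal.
by apply: commrB; [exact: commrM | exact: commr1].
Qed.

(** Polar decomposition: [w] is the modulus of [z] and [s] its sign. *)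
Lemma polar z : sa z -> inv z ->
  exists s w, [/\ sa s, s * s = 1, isq w, z = s * w & w * w = z * z].
Proof.
move=> sz iz; have qz : isq (z * z) by exists z.
have [w [qw ww bw]] := sqrt_of_isq qz.
have zw : GRing.comm z w by apply: bw; exact: commrM.
have [v [wv vw]] : inv w by apply: (@inv_mull _ _ w w) => //; rewrite ww; exact: invM.
have zv : GRing.comm z v by apply: (inv_comm wv vw).
have vC : GRing.comm v w by rewrite /GRing.comm vw wv.
have sv : sa v.
  have h1 : st v * w = 1 by rewrite -(isq_sa qw) -stM wv st1.
  by rewrite /sa -[LHS]mulr1 -wv mulrA h1 mul1r.
exists (z * v), w; split=> //; first exact: saM.
  by rewrite comm_mulACA// -ww -comm_mulACA// wv mulr1.
by rewrite -mulrA vw mulr1.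
Qed.

(** Take an invertible [z = s w] near [b], with sign [s] and modulus [w].  As [w] lies
    between [0] and about [nrm b], it differs from half the norm of [b] by about that
    much, and so does [b] from the central element [(nrm b / 2) s].  The approximation
    errors fit into the gap between [1 / 2] and [2 / 3]. *)
Lemma central_step b : real_rank_eq A 0 ->
  (forall s, sa s -> s * s = 1 -> forall x, GRing.comm s x) ->
  sa b -> b != 0 ->
  exists c, [/\ sa c, forall x, GRing.comm c x & nrm (b - c) <= 2 / 3 * nrm b].
Proof.
move=> /real_rank0P rr cs sb b0; set m := nrm b; have m0 : 0 < m by exact: nrm_gt0.
pose h := m / 12; have h0 : 0 < h by rewrite divr_gt0.
have [z [sz iz bz]] := rr b sb h h0.
have [s [w [ss s1 qw zE ww]]] := polar sz iz.
have zM : nrm z <= m + h.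
  by have := nrm_le_sub b (b - z); rewrite opprB addrC subrK -/m; lra.
have wz : nrm w = nrm z.
  apply/eqP; rewrite -(@eqrXn2 _ 2)// ?nrm_ge0// -!nrm_sqr//; last exact: isq_sa.
  by rewrite ww.
pose M := m + h; have M0 : 0 < M by rewrite addr_gt0.
have M2 : rscal (M / 2) + rscal (M / 2) = rscal M by rewrite -rmorphD/=; congr rscal; lra.
have qMw : isq (rscal M - w).
  apply: (isq_of_norm M0); first by apply: saB; [exact: sa_rscal | exact: isq_sa].
  by rewrite opprB addrC subrK wz.
have wM : nrm (w - rscal (M / 2)) <= M / 2.
  apply: norm_le_of_order; first by rewrite divr_gt0.
  - by apply: saB; [exact: isq_sa | exact: sa_rscal].
  - by rewrite opprB addrA M2.
  - by rewrite addrC subrK.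
have ns : nrm s <= 1.
  have := nrm_sqr ss; rewrite s1 => e1; have := nrm1_le A; have := nrm_ge0 s; nra.
exists (rscal (m / 2) * s); split.
- exact: saZ.
- move=> x; apply/commr_sym; apply: commrM; first exact: comm_rscal.
  exact/commr_sym/cs.
have -> : b - rscal (m / 2) * s = (b - z) + s * (w - rscal (M / 2) + rscal (h / 2)).
  have -> : w - rscal (M / 2) + rscal (h / 2) = w - rscal (m / 2).
    have -> : M / 2 = m / 2 + h / 2 by rewrite /M; lra.
    by rewrite rmorphD/= opprD addrA subrK.
  by rewrite {1}zE mulrBr addrA subrK rscalC.
have := nrm_le_add (b - z) (s * (w - rscal (M / 2) + rscal (h / 2))).
have := nrm_le_mul s (w - rscal (M / 2) + rscal (h / 2)).
have := nrm_le_add (w - rscal (M / 2)) (rscal (h / 2)).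
have := nrm_rscal_le A (h / 2); rewrite gtr0_norm; last by rewrite divr_gt0.
have := nrm_ge0 (w - rscal (M / 2) + rscal (h / 2)); have := nrm_ge0 s.
move: bz wM ns; rewrite /M /h -/m; nra.
Qed.

(** By [central_step] the distance from [b] to the self-adjoint central elements is at
    most two thirds of itself, so it is [0]. *)
Lemma central_dense b : real_rank_eq A 0 ->
  (forall s, sa s -> s * s = 1 -> forall x, GRing.comm s x) ->
  sa b -> forall x, GRing.comm b x.
Proof.
move=> rr cs sb x; apply: comm_of_approx => e e0.
pose D : set R := [set r | exists c, [/\ sa c, forall x, GRing.comm c x & nrm (b - c) = r]].
have iD : has_inf D.
  split; last by exists 0 => _ [c [_ _ <-]]; exact: nrm_ge0.
  exists (nrm (b - 0)), 0; split=> //; first exact: raddf0.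
  by move=> y; apply/commr_sym/commr0.
have D0 : 0 <= inf D by apply: lb_le_inf; [case: iD | move=> _ [c [_ _ <-]]; exact: nrm_ge0].
have {}D0 : inf D = 0.
  apply/le_anti; rewrite D0 andbT leNgt; apply/negP => Dp.
  have [|_ [c [sc cc <-]] hc] := @inf_adherent _ D (inf D / 3) _ iD; first by rewrite divr_gt0.
  have bc0 : b - c != 0.
    rewrite -nrm_eq0 gt_eqF//; apply: lt_le_trans Dp _.
    by apply: ge_inf; [case: iD | exists c].
  have [c' [sc' cc' h]] := central_step rr cs (saB sb sc) bc0.
  have : inf D <= nrm (b - c - c').
    apply: ge_inf; first by case: iD.
    exists (c + c'); rewrite opprD addrA; split=> //; first exact: saD.
    by move=> y; apply/commr_sym/commrD; exact/commr_sym.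
  lra.
have [_ [c [sc cc <-]]] := inf_adherent e0 iD; rewrite D0 add0r => hc.
by exists c.
Qed.

Lemma open_commutative : (forall x, sa x -> square_open_at x) -> commutative_alg A.
Proof.
move=> H x y; have rr := open_real_rank0 H.
have cs s : sa s -> s * s = 1 -> forall x, GRing.comm s x.
  by move=> ss; apply: open_symmetry_central; exact: H.
apply: (comm_of_sa (y := x)) => b sb.
by apply/commr_sym/central_dense.
Qed.

End Openness.

(** * Real rank zero and commutativity force openness *)

Section RealEval.
Context (R : realType) (A : cstarAlgType R) (chi : alg A -> Cplx R).
Hypothesis chiP : is_char chi.
Local Notation C := (Cplx R).
Local Notation B := (alg A).
Implicit Types (x y a : B) (r : R).

Definition ev x : R := complex.Re (chi x).

Lemma evE x : sa x -> chi x = (ev x)%:C%C.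
Proof.
move=> sx; have := char_st chiP x; rewrite sx /ev; case: (chi x) => u v /= [] vN.
by congr Complex; lra.
Qed.

Lemma evD x y : ev (x + y) = ev x + ev y.
Proof. by rewrite /ev (charD chiP); case: (chi x); case: (chi y). Qed.
Lemma evB x y : ev (x - y) = ev x - ev y.
Proof. by rewrite /ev (charB chiP); case: (chi x); case: (chi y). Qed.
Lemma ev_rscal r : ev (rscal A r) = r.
Proof. by rewrite /ev (char_cscal chiP). Qed.
Lemma evM x y : sa x -> sa y -> ev (x * y) = ev x * ev y.
Proof. by move=> sx sy; rewrite {1}/ev (charM chiP) (evE sx) (evE sy) -rmorphM. Qed.
Lemma evZ r x : sa x -> ev (rscal A r * x) = r * ev x.
Proof. by move=> sx; rewrite evM// ?ev_rscal//; exact: sa_rscal. Qed.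
Lemma ev_isq x : isq x -> 0 <= ev x.
Proof. by move=> [b sb ->]; rewrite evM// -expr2 sqr_ge0. Qed.
Lemma ev_le x : sa x -> `|ev x| <= nrm x.
Proof.
move=> sx; have := char_bound chiP x; rewrite (evE sx).
by rewrite normc_def/= expr0n addr0 sqrtr_sqr lecR.
Qed.
Lemma ev_symmetry s : sa s -> s * s = 1 -> ev s = 1 \/ ev s = -1.
Proof.
move=> ss s1; have /eqP : ev s ^+ 2 = 1 by rewrite expr2 -evM// s1 /ev (char1 chiP).
by rewrite sqrf_eq1 => /orP[]/eqP; [left | right].
Qed.
End RealEval.

Section Commutative.
Context (R : realType) (A : cstarAlgType R) (cA : commutative_alg A).
Local Notation C := (Cplx R).
Local Notation B := (alg A).
Implicit Types (x y z a b c s w : B) (r t m e d : R).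

Lemma saM_of_commutative x y : sa x -> sa y -> sa (x * y).
Proof. by move=> sx sy; apply: saM => //; exact: cA. Qed.

Lemma nrm_le_ev c m : 0 <= m -> sa c ->
  (forall chi : B -> C, is_char chi -> `|ev chi c| <= m) -> nrm c <= m.
Proof.
move=> m0 sc h; have [->|c0] := eqVneq c 0; first by rewrite nrm0.
have [chi hchi] := @exists_char R A cA c sc c0.
rewrite (evE hchi sc) -rmorphXn => -[] /eqP; rewrite eqf_sqr => e.
have := h _ hchi; case/orP: e => /eqP ->; rewrite ?normrN ger0_norm ?nrm_ge0//.
Qed.

(** If [u >= 0], then [(u - n) ^ 2] is at most [|u ^ 2 - n ^ 2|]; if [u < 0], then
    [u >= - g] and [n ^ 2] is at most [2 g ^ 2]. *)
Lemma nearby_root (u v n g : R) : 0 < g -> 0 <= v -> 0 <= n ->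
  `|u - v| <= g -> `|u ^+ 2 - n ^+ 2| <= g ^+ 2 -> `|u - n| <= 3 * g.
Proof.
move=> g0 v0 n0; rewrite !ler_norml => /andP[h1 h2] /andP[h3 h4].
have [u0|u0] := leP 0 u; apply/andP; split; nra.
Qed.

(** The root of [a] near [x] is [s v], where [v] is the positive root of [a] and [s] is
    the sign of an invertible [z] near [x].  The distance is estimated on characters,
    where [s] takes the values [1] and [-1]. *)
Lemma real_rank0_open : real_rank_eq A 0 -> forall x, sa x -> square_open_at x.
Proof.
move=> /real_rank0P rr x sx e e0; pose g := e / 4; have g0 : 0 < g by rewrite divr_gt0.
have [z [sz iz xz]] := rr x sx g g0.
have [s [w [ss s1 qw zE _]]] := polar sz iz.
exists (g ^+ 2); first by rewrite exprn_gt0.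
move=> a qa xa; have [v [qv vv _]] := sqrt_of_isq qa.
have sv := isq_sa qv; have sw := isq_sa qw.
have ssv : sa (s * v) by exact: saM_of_commutative.
exists (s * v); split=> //.
  by rewrite comm_mulACA ?s1 ?mul1r//; exact: cA.
suff : nrm (x - s * v) <= 3 * g by rewrite /g; lra.
apply: nrm_le_ev; [by rewrite mulr_ge0// ltW | exact: saB |] => chi hchi.
have E1 : `|ev chi x - ev chi s * ev chi w| <= g.
  rewrite -(evM hchi ss sw) -zE -(evB hchi); apply: le_trans (ev_le hchi _) (ltW xz).
  exact: saB.
have E2 : `|ev chi x ^+ 2 - ev chi v ^+ 2| <= g ^+ 2.
  rewrite !expr2 -!(evM hchi)// vv -(evB hchi); apply: le_trans (ev_le hchi _) (ltW xa).
  by apply: saB; [exact: saM_of_commutative | exact: isq_sa].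
have w0 := ev_isq hchi qw; have v0 := ev_isq hchi qv.
rewrite (evB hchi) (evM hchi ss sv).
case: (ev_symmetry hchi ss s1) E1 => ->; rewrite ?mul1r => E1.
  exact: nearby_root E1 E2.
have flip t : `|ev chi x - -1 * t| = `|- ev chi x - t| by rewrite -normrN; congr `|_|; ring.
rewrite flip; apply: (nearby_root g0 w0 v0); first by rewrite -flip.
by rewrite sqrrN.
Qed.
End Commutative.

(** * Continuity and compactness *)

Section ComplexContinuity.
Context (R : realType) (X : topologicalType).
Local Notation C := (Cplx R).

Lemma Re_le_norm (k : C) : ((`|complex.Re k|)%:C%C : C) <= `|k|.
Proof.
case: k => a b; rewrite normc_def/= lecR -[`|a|]sqrtr_sqr ler_sqrt ?addr_ge0 ?sqr_ge0//.
by rewrite lerDl sqr_ge0.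
Qed.
Lemma Im_le_norm (k : C) : ((`|complex.Im k|)%:C%C : C) <= `|k|.
Proof.
case: k => a b; rewrite normc_def/= lecR -[`|b|]sqrtr_sqr ler_sqrt ?addr_ge0 ?sqr_ge0//.
by rewrite lerDr sqr_ge0.
Qed.
Lemma normc_le_add (a b : R) : `|Complex a b : C| <= ((`|a| + `|b|)%:C%C : C).
Proof.
rewrite normc_def/= lecR -[leRHS]ger0_norm ?addr_ge0// -sqrtr_sqr.
rewrite ler_sqrt ?sqr_ge0// -(real_normK (num_real a)) -(real_normK (num_real b)).
have := normr_ge0 a; have := normr_ge0 b; nra.
Qed.

Lemma continuous_Re (f : X -> C) : continuous f -> continuous (fun x => complex.Re (f x)).
Proof.
move=> cf x; apply/cvgrPdist_lt => e e0.
have e0' : 0 < (e%:C%C : C) by rewrite ltcR.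
have /cvgrPdist_lt/(_ _ e0') := cf x; apply: filterS => y.
move=> h; rewrite -ltcR; apply: le_lt_trans h.
by apply: le_trans (Re_le_norm _); rewrite lecR; case: (f x) => a b; case: (f y).
Qed.
Lemma continuous_Im (f : X -> C) : continuous f -> continuous (fun x => complex.Im (f x)).
Proof.
move=> cf x; apply/cvgrPdist_lt => e e0.
have e0' : 0 < (e%:C%C : C) by rewrite ltcR.
have /cvgrPdist_lt/(_ _ e0') := cf x; apply: filterS => y.
move=> h; rewrite -ltcR; apply: le_lt_trans h.
by apply: le_trans (Im_le_norm _); rewrite lecR; case: (f x) => a b; case: (f y).
Qed.

Lemma continuous_Complex (u v : X -> R) : continuous u -> continuous v ->
  continuous (fun x => Complex (u x) (v x) : C).
Proof.
move=> cu cv x; apply/cvgrPdist_lt => _ /Cplx_gt0[e e0 ->].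
have e2 : 0 < e / 2 by rewrite divr_gt0.
have /cvgrPdist_lt/(_ _ e2) hu := cu x; have /cvgrPdist_lt/(_ _ e2) hv := cv x.
near=> y; apply: le_lt_trans (normc_le_add (u x - u y) (v x - v y)) _.
rewrite ltcR (splitr e); apply: ltrD; near: y; [exact: hu | exact: hv].
Unshelve. all: by end_near. Qed.

Lemma continuous_conj (f : X -> C) : continuous f -> continuous (fun x => Num.conj (f x)).
Proof.
move=> cf x; apply/cvgrPdist_lt => e e0.
have /cvgrPdist_lt/(_ _ e0) := cf x; apply: filterS => y.
by rewrite -rmorphB norm_conjC.
Qed.

Lemma continuous_addC (f g : X -> C) : continuous f -> continuous g ->
  continuous (fun x => f x + g x).
Proof. by move=> cf cg x; exact: (@cvgD C C X (nbhs x) _ f g _ _ (cf x) (cg x)). Qed.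

Lemma continuous_mulC (f g : X -> C) : continuous f -> continuous g ->
  continuous (fun x => f x * g x).
Proof. by move=> cf cg x; exact: (@cvgM C X (nbhs x) _ f g _ _ (cf x) (cg x)). Qed.

Lemma closed_eq_fun (f g : X -> C) : continuous f -> continuous g ->
  closed [set x | f x = g x].
Proof.
move=> cf cg; rewrite (_ : [set _ | _] = (fun x => f x - g x) @^-1` [set 0]).
  apply: preimage_closed.
    by move=> x _; exact: (@cvgB C C X (nbhs x) _ f g (f x) (g x) (cf x) (cg x)).
  exact/accessible_closed_set1/hausdorff_accessible/(@norm_hausdorff C C^o).
by apply/seteqP; split=> x /= => [->|/eqP]; rewrite ?subrr// subr_eq0 => /eqP.
Qed.
End ComplexContinuity.

Definition Cbox (R : realType) (r : R) : set (Cplx R) :=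
  [set k | `|complex.Re k| <= r /\ `|complex.Im k| <= r].

Lemma compact_Cbox (R : realType) (r : R) : compact (Cbox r).
Proof.
pose f (p : R * R) : Cplx R := Complex p.1 p.2.
rewrite (_ : Cbox r = f @` (`[-r, r] `*` `[-r, r])); last first.
  apply/seteqP; split=> [[a b] [/= ha hb]|_ [[a b] [/= ha hb] <-]].
    by exists (a, b) => //; split; rewrite /= in_itv/= -ler_norml.
  by move: ha hb; rewrite !in_itv/= -!ler_norml.
apply: continuous_compact; last by apply: compact_setX; exact: segment_compact.
apply: continuous_subspaceT; apply: continuous_Complex.
  by move=> x; exact: cvg_fst.
by move=> x; exact: cvg_snd.
Qed.

Section RowContinuity.
Context (R : realType) (X : topologicalType).

Lemma continuous_subr_cst (f : X -> R) (c : R) : continuous f ->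
  continuous (fun x => f x - c).
Proof. by move=> cf x; apply: cvgB; [exact: cf | exact: cvg_cst]. Qed.

Lemma continuous_const_rV1 (f : X -> R) : continuous f ->
  continuous (fun x => const_mx (f x) : 'rV[R]_1).
Proof.
move=> cf x; apply/cvg_ballP => e e0.
have /cvg_ballP/(_ _ e0) := cf x; apply: filterS => y h; split=> // i j.
by rewrite !mxE.
Qed.

Lemma continuous_rV1_entry (f : X -> 'rV[R]_1) : continuous f ->
  continuous (fun x => f x ord0 ord0).
Proof.
move=> cf x; apply/cvg_ballP => e e0.
by have /cvg_ballP/(_ _ e0) := cf x; apply: filterS => y [_]; apply.
Qed.

Lemma within_continuous_rV1 (F : set X) (f : X -> 'rV[R]_1) :
  {within F, continuous f} -> forall x, F x -> forall e : R, 0 < e ->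
  \forall y \near x, F y -> `|f x ord0 ord0 - f y ord0 ord0| < e.
Proof.
move=> /subspace_continuousP cf x Fx e e0.
have /cvg_ballP/(_ _ e0) := cf x Fx; rewrite near_withinE; apply: filterS => y h Fy.
by have [_ /(_ ord0 ord0)] := h Fy; rewrite -ball_normE.
Qed.

Lemma within_continuous_const_rV1 (F : set X) (h : X -> R) :
  (forall x, F x -> forall e : R, 0 < e -> \forall y \near x, F y -> `|h x - h y| < e) ->
  {within F, continuous (fun x => const_mx (h x) : 'rV[R]_1)}.
Proof.
move=> ch; apply/subspace_continuousP => x Fx; apply/cvg_ballP => e e0.
rewrite near_withinE; have := ch x Fx e e0; apply: filterS => y hy Fy; split=> // i j.
by rewrite !mxE -ball_normE; exact: hy.
Qed.
End RowContinuity.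

Section Compactness.
Context (X : topologicalType).
Hypothesis cX : compact [set: X].

(** A directed family of properties that hold locally: finitely many indices suffice
    by compactness, and directedness replaces them by one. *)
Lemma directed_compact (I : Type) (D : set I) (P : I -> X -> Prop) :
  D !=set0 ->
  (forall a b, D a -> D b -> exists2 c, D c & forall x, P a x \/ P b x -> P c x) ->
  (forall x : X, exists2 a, D a & \forall x' \near x, P a x') ->
  exists2 a, D a & forall x, P a x.
Proof.
move=> D0 dir loc.
pose F := filter_from D (fun a => [set b | D b /\ forall x, P a x -> P b x]).
have FF : Filter F.
  apply: filter_from_filter => // a b /dir h /h[c Dc hc].
  by exists c => // d [Dd cd]; split; split=> // x h'; apply: cd; apply: hc; [left|right].
have /compact_near_coveringP/(_ I F P FF)[|a Da ha] := cX; last first.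
  by exists a => // x; apply: ha.
move=> x _; have [a Da ha] := loc x.
exists ([set x' | P a x'], [set b | D b /\ forall x, P a x -> P b x]) => /=.
  by split=> //; exists a.
by move=> [y b]/= [Pay [_ h]]; apply: h.
Qed.

(** For each [x], maxima of interpolating functions yield a member of [L] that is above
    [u - e] everywhere and not above [u] at [x]; minima of these are also below
    [u + e]. *)
Lemma lattice_Stone_Weierstrass (R : realType) (L : set (X -> R)) (u : X -> R) (e : R) :
  0 < e -> continuous u -> L !=set0 -> (forall f, L f -> continuous f) ->
  (forall f g, L f -> L g -> L (fun x => Num.max (f x) (g x))) ->
  (forall f g, L f -> L g -> L (fun x => Num.min (f x) (g x))) ->
  (forall x y, exists f, [/\ L f, f x = u x & f y = u y]) ->
  exists2 f, L f & forall x, `|f x - u x| < e.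
Proof.
move=> e0 cu L0 cL maxL minL interp.
have near_lt (f g : X -> R) x : continuous f -> continuous g -> f x < g x ->
    \forall x' \near x, f x' < g x'.
  move=> cf cg fg; pose d := (g x - f x) / 2.
  have d0 : 0 < d by rewrite divr_gt0 ?subr_gt0.
  have /cvgrPdist_lt/(_ _ d0) hf := cf x; have /cvgrPdist_lt/(_ _ d0) hg := cg x.
  near=> y.
  have : `|f x - f y| < d by near: y; exact: hf.
  have : `|g x - g y| < d by near: y; exact: hg.
  by rewrite !ltr_norml /d => /andP[h1 h2] /andP[h3 h4]; lra.
have cuB : continuous (fun y => u y - e).
  by move=> y; apply: cvgB; [exact: cu | exact: cvg_cst].
have cuD : continuous (fun y => u y + e).
  by move=> y; apply: cvgD; [exact: cu | exact: cvg_cst].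
have above x : exists f, [/\ L f, f x <= u x & forall y, u y - e < f y].
  have [|||f [Lf fx] hf] := @directed_compact (X -> R) [set f | L f /\ f x <= u x]
      (fun f y => u y - e < f y); last by exists f.
  - by have [f [Lf fx _]] := interp x x; exists f; rewrite /= fx.
  - move=> f g [Lf fx] [Lg gx]; exists (fun y => Num.max (f y) (g y)).
      by split; [exact: maxL | rewrite ge_max fx].
    by move=> y [h|h]; rewrite lt_max h ?orbT.
  - move=> y; have [f [Lf fx fy]] := interp x y.
    exists f; first by rewrite /= fx.
    by apply: (near_lt _ _ _ cuB (cL _ Lf)); rewrite fy; lra.
have [|||f [Lf fl] fu] := @directed_compact (X -> R) [set f | L f /\ forall y, u y - e < f y]
    (fun f y => f y < u y + e).
- have [[x _]|nX] := pselect ([set: X] !=set0); last first.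
    by case: L0 => f Lf; exists f; split=> // y; case: nX; exists y.
  by have [f [Lf _ hf]] := above x; exists f.
- move=> f g [Lf fx] [Lg gx]; exists (fun y => Num.min (f y) (g y)).
    by split; [exact: minL | move=> y; rewrite lt_min fx gx].
  by move=> y [h|h]; rewrite gt_min h ?orbT.
- move=> x; have [f [Lf fx hf]] := above x; exists f => //.
  by apply: (near_lt _ _ _ (cL _ Lf) cuD); lra.
exists f => // x; rewrite ltr_norml; apply/andP.
by have := fl x; have := fu x; lra.
Unshelve. all: by end_near. Qed.

End Compactness.

(** * The space of characters *)

Section CharSpace.
Context (R : realType) (A : cstarAlgType R).
Local Notation C := (Cplx R).
Local Notation B := (alg A).

Definition chars : set {ptws B -> C} := [set chi | is_char (chi : B -> C)].

Definition char_space : topologicalType := set_type chars.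

Implicit Types (x y a b c : B) (p q : char_space).

Definition char_of (p : char_space) : B -> C := val p.

Lemma char_ofP p : is_char (char_of p).
Proof. exact: set_mem (valP p). Qed.

Lemma char_point (chi : B -> C) : is_char chi -> exists p, char_of p = chi.
Proof. by move=> h; exists (SigSub (mem_set h : (chi : {ptws B -> C}) \in chars)). Qed.

Lemma proj_char_continuous x : continuous (fun chi : {ptws B -> C} => chi x).
Proof. exact: (@proj_continuous B (fun=> C) x). Qed.

Lemma eval_continuous x : continuous (fun p => char_of p x).
Proof.
move=> p; apply: (@continuous_comp char_space {ptws B -> C} C val (fun chi => chi x)).
  exact: initial_continuous.
exact: proj_char_continuous.
Qed.

Lemma closed_chars : closed chars.
Proof.
pose K1 := \bigcap_(xy in [set: B * B]) [set chi : {ptws B -> C} | chi (xy.1 + xy.2) = chi xy.1 + chi xy.2].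
pose K2 := \bigcap_(kx in [set: C * B]) [set chi : {ptws B -> C} | chi (kx.1 *: kx.2) = kx.1 * chi kx.2].
pose K3 := \bigcap_(xy in [set: B * B]) [set chi : {ptws B -> C} | chi (xy.1 * xy.2) = chi xy.1 * chi xy.2].
pose K4 := \bigcap_(x in [set: B]) [set chi : {ptws B -> C} | chi (st x) = Num.conj (chi x)].
pose K5 := [set chi : {ptws B -> C} | chi 1 = 1].
have -> : chars = K1 `&` K2 `&` K3 `&` K4 `&` K5.
  apply/seteqP; split=> [chi [h1 h2 h3 h4 h5]|chi [[[[h1 h2] h3] h4] h5]].
    by repeat split => //; [move=> [x y] _; exact: h1 | move=> [k x] _; exact: h2 | move=> [x y] _; exact: h3 | move=> x _; exact: h4].
  split=> //.
  - by move=> x y; exact: (h1 (x, y)).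
  - by move=> k x; exact: (h2 (k, x)).
  - by move=> x y; exact: (h3 (x, y)).
  - by move=> x; exact: (h4 x).
repeat apply: closedI.
- apply: closed_bigI => -[x y] _; apply: closed_eq_fun; first exact: proj_char_continuous.
  exact: (continuous_addC (@proj_char_continuous x) (@proj_char_continuous y)).
- apply: closed_bigI => -[k x] _; apply: closed_eq_fun; first exact: proj_char_continuous.
  have ck : continuous (fun _ : {ptws B -> C} => k) by apply: cst_continuous.
  exact: (continuous_mulC ck (@proj_char_continuous x)).
- apply: closed_bigI => -[x y] _; apply: closed_eq_fun; first exact: proj_char_continuous.
  exact: (continuous_mulC (@proj_char_continuous x) (@proj_char_continuous y)).
- apply: closed_bigI => x _; apply: closed_eq_fun; first exact: proj_char_continuous.
  by apply: continuous_conj; exact: proj_char_continuous.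
- by apply: closed_eq_fun; [exact: proj_char_continuous | apply: cst_continuous].
Qed.

(** A character at [x] is bounded by the norm of [x], so that the characters form a
    closed subset of a product of compact boxes. *)
Lemma compact_chars : compact chars.
Proof.
pose box := [set chi : {ptws B -> C} | forall x, Cbox (nrm x) (chi x)].
apply: (@subclosed_compact _ _ box); first exact: closed_chars.
  by apply: (@tychonoff B (fun=> C) (fun x => Cbox (nrm x))) => x; exact: compact_Cbox.
move=> chi hchi x; have h := char_bound hchi x; split; rewrite -lecR; apply: le_trans h.
  exact: Re_le_norm.
exact: Im_le_norm.
Qed.

Lemma compact_char_space : compact [set: char_space].
Proof.
move=> F FF _; pose G := [set U : set {ptws B -> C} | F (val @^-1` U)].
have FG : ProperFilter G by exact: (@fmap_proper_filter _ _ val F FF).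
have [|chi [hchi cl]] := compact_chars FG.
  by apply: (@filterE _ F) => p; exact: char_ofP.
have [p pE] := char_point hchi; exists p; split=> // U V FU [_ [[W oW <-] Wp] WV].
have GU : G (val @` U) by apply: (@filterS _ F _ U) => // x Ux; exists x.
have Wchi : nbhs chi W by apply: open_nbhs_nbhs; split; rewrite // -pE.
have [_ [[x Ux <-] Wx]] := cl _ _ GU Wchi.
by exists x; split=> //; apply: WV.
Qed.

Lemma hausdorff_char_space : hausdorff_space char_space.
Proof.
move=> p q cl; apply/val_inj/funext => x.
apply: (@norm_hausdorff C C) => U V Up Vq.
have [r [Ur Vr]] := cl _ _ (eval_continuous Up) (eval_continuous Vq).
by exists (char_of r x).
Qed.

Definition evp (p : char_space) x : R := ev (char_of p) x.

Lemma evp_continuous x : continuous (fun p => evp p x).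
Proof. exact/continuous_Re/eval_continuous. Qed.

End CharSpace.

(** * The Gelfand isomorphism in real rank zero *)

Section Gelfand.
Context (R : realType) (A : cstarAlgType R) (cA : commutative_alg A).
Local Notation C := (Cplx R).
Local Notation B := (alg A).
Local Notation X := (char_space A).
Implicit Types (x y a b c d : B) (p q : X) (r t : R).

Lemma evp_bound p a : sa a -> `|evp p a| <= nrm a.
Proof. exact: (ev_le (char_ofP p)). Qed.

Lemma nrm_le_evp c m : 0 <= m -> sa c -> (forall p, `|evp p c| <= m) -> nrm c <= m.
Proof.
move=> m0 sc h; apply: (nrm_le_ev cA) => // chi /char_point[p <-]; exact: h.
Qed.

Lemma char_ofE p x : char_of p x = Complex (evp p (re_part x)) (evp p (im_part x)).
Proof.
have hp := char_ofP p.
rewrite {1}(re_im_partE x) (charD hp) (charM hp) (char_cscal hp).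
rewrite (evE hp (sa_re_part x)) (evE hp (sa_im_part x)) /evp.
by apply/eqP; rewrite eq_complex/=; apply/andP; split; apply/eqP; ring.
Qed.

Lemma char_space_separated p q : p <> q -> exists2 d, sa d & evp p d <> evp q d.
Proof.
move=> pq; apply: contrapT => h; apply: pq; apply/val_inj/funext => x.
have e a : sa a -> evp p a = evp q a.
  by move=> sa_a; apply: contrapT => ne; apply: h; exists a.
by rewrite -[LHS]/(char_of p x) -[RHS]/(char_of q x) !char_ofE !e//; [exact: sa_im_part | exact: sa_re_part].
Qed.

Lemma exists_abs a : sa a -> exists2 w, sa w & forall p, evp p w = `|evp p a|.
Proof.
move=> sa_a; have [|w [qw ww _]] := @sqrt_of_isq R A (a * a); first by exists a.
have sw := isq_sa qw; exists w => // p; have hp := char_ofP p.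
have w0 := ev_isq hp qw.
apply/eqP; rewrite -(@eqrXn2 _ 2)// real_normK ?num_real// !expr2.
by rewrite -(evM hp)// -(evM hp)// ww.
Qed.

Lemma exists_max a b : sa a -> sa b ->
  exists2 c, sa c & forall p, evp p c = Num.max (evp p a) (evp p b).
Proof.
move=> sa_a sb; have [w sw hw] := exists_abs (saB sa_a sb).
have s1 : sa (a + b + w) by apply: saD => //; exact: saD.
exists (rscal A 2^-1 * (a + b + w)); first exact: saZ.
move=> p; have hp := char_ofP p.
rewrite /evp (evZ hp)// !(evD hp) -/(evp p w) hw /evp (evB hp) maxr_absE.
by rewrite mulrC.
Qed.

Lemma exists_min a b : sa a -> sa b ->
  exists2 c, sa c & forall p, evp p c = Num.min (evp p a) (evp p b).
Proof.
move=> sa_a sb; have [w sw hw] := exists_abs (saB sa_a sb).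
have s1 : sa (a + b - w) by apply: saB => //; exact: saD.
exists (rscal A 2^-1 * (a + b - w)); first exact: saZ.
move=> p; have hp := char_ofP p.
rewrite /evp (evZ hp)// (evB hp) (evD hp) -/(evp p w) hw /evp (evB hp) minr_absE.
by rewrite mulrC.
Qed.

(** A self-adjoint element that separates the two points, corrected by an affine
    map. *)
Lemma interpolation (u : X -> R) p q :
  exists a, [/\ sa a, evp p a = u p & evp q a = u q].
Proof.
have [<-|/char_space_separated[d sd ne]] := pselect (p = q).
  by exists (rscal A (u p)); split; [exact: sa_rscal | |]; rewrite /evp (ev_rscal (char_ofP _)).
pose al := (u p - u q) / (evp p d - evp q d).
have ne0 : evp p d - evp q d != 0 by rewrite subr_eq0; apply/eqP.
exists (rscal A al * d + rscal A (u p - al * evp p d)); split.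
- by apply: saD; [exact: saZ | exact: sa_rscal].
- rewrite /evp (evD (char_ofP p)) (evZ (char_ofP p))// (ev_rscal (char_ofP p)).
  by rewrite addrC subrK.
- rewrite /evp (evD (char_ofP q)) (evZ (char_ofP q))// (ev_rscal (char_ofP q)).
  rewrite -/(evp q d) -/(evp p d) /al; field; exact: ne0.
Qed.

Lemma evp_dense (u : X -> R) (e : R) : 0 < e -> continuous u ->
  exists2 a, sa a & forall p, `|evp p a - u p| < e.
Proof.
move=> e0 cu; pose L := [set f : X -> R | exists2 a, sa a & f = (fun p => evp p a)].
have [|||||_ [a sa_a ->] h] :=
    lattice_Stone_Weierstrass (@compact_char_space R A) (L := L) e0 cu.
- by exists (fun p => evp p 1), 1 => //; exact: sa1.
- by move=> _ [a _ ->]; exact: evp_continuous.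
- move=> _ _ [a sa_a ->] [b sb ->]; have [c sc hc] := exists_max sa_a sb.
  by exists c => //; apply/funext => p; rewrite hc.
- move=> _ _ [a sa_a ->] [b sb ->]; have [c sc hc] := exists_min sa_a sb.
  by exists c => //; apply/funext => p; rewrite hc.
- move=> p q; have [a [sa_a h1 h2]] := interpolation u p q.
  by exists (fun p => evp p a); split=> //; exists a.
by exists a.
Qed.

(** Approximants with error [2 ^- n] form a sequence dominated by [- 3 * 2 ^- n]. *)
Lemma evp_surj (u : X -> R) : continuous u -> exists2 a, sa a & forall p, evp p a = u p.
Proof.
move=> cu; pose g n : R := 2^-1 ^+ n.
have g0 n : 0 < g n by rewrite exprn_gt0.
have /choice[a ha] : forall n, exists a, sa a /\ forall p, `|evp p a - u p| < g n.
  by move=> n; have [a] := evp_dense (g0 n) cu; exists a.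
have sa_a n : sa (a n) by case: (ha n).
have [l al] : exists l, limto a l.
  apply: (@dominated_limto _ _ _ (fun n => - 3 * g n) 0) => n; last first.
    by rewrite mulNr oppr_le0 mulr_ge0// ltW.
  have gS : g n.+1 = 2^-1 * g n by rewrite /g exprS.
  apply: nrm_le_evp; [have := g0 n; lra | exact: saB | move=> p].
  rewrite /evp (evB (char_ofP p)) -!/(evp p _).
  have [_ /(_ p) h1] := ha n; have [_ /(_ p) h2] := ha n.+1.
  have := ler_normB (evp p (a n.+1) - u p) (evp p (a n) - u p).
  by rewrite opprB addrA subrK gS in h2 *; lra.
have sl : sa l.
  by apply: (limto_unique (limto_st al)); move: al; congr limto; apply/funext => n; rewrite sa_a.
exists l => // p; apply/eqP; rewrite -subr_eq0 -normr_eq0; apply/eqP.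
apply: (@small_eq0 _ _ 2); first exact: normr_ge0.
move=> e e0; have [N hN] := al e e0.
have [M hM] : exists M, forall n, (M <= n)%N -> g n < e.
  have /cvgrPdist_lt/(_ _ e0)[M _ hM] : g @ \oo --> 0.
    by apply: cvg_expr; rewrite ger0_norm// invf_lt1// ltr1n.
  by exists M => n /hM; rewrite /= sub0r normrN gtr0_norm.
pose n := maxn N M; have := hN n (leq_maxl _ _); have := hM n (leq_maxr _ _).
have [_ /(_ p) h1] := ha n.
have := evp_bound p (saB (sa_a n) sl); rewrite /evp (evB (char_ofP p)) -!/(evp p _).
have := ler_distD (evp p (a n)) (evp p l) (u p); rewrite (distrC (evp p l) (evp p (a n))).
lra.
Qed.

Definition gelfand x : continuousType X C := mkcts (@eval_continuous R A x).

(** If [x] and [y] agree on characters, then all of them vanish at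
    [(x - y)^* (x - y)], whose norm is [nrm (x - y) ^ 2]. *)
Lemma gelfand_inj : injective gelfand.
Proof.
move=> x y e; apply/eqP; rewrite -subr_eq0 -nrm_eq0.
pose d := x - y; pose a := st d * d.
have sa_a : sa a by rewrite /sa stM stK.
have : nrm a <= 0.
  apply: nrm_le_evp => // p; have hp := char_ofP p.
  rewrite /evp /ev (charM hp) (charB hp); have -> : char_of p x = char_of p y.
    by have := congr1 (fun f : continuousType X C => f p) e.
  by rewrite subrr mulr0 normr0.
by rewrite nrm_star_mul => h; rewrite -sqrf_eq0 eq_le h sqr_ge0.
Qed.

Lemma gelfand_surj (f : continuousType X C) : exists x, gelfand x = f.
Proof.
have cf : continuous f by exact: cts_fun.
have [a sa_a ha] := evp_surj (continuous_Re cf).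
have [b sb hb] := evp_surj (continuous_Im cf).
exists (a + cscal A ('i%C : C) * b); apply/continuousEP => p.
have hp := char_ofP p.
rewrite -[LHS]/(char_of p _) (charD hp) (charM hp) (char_cscal hp).
rewrite (evE hp sa_a) (evE hp sb) -/(evp p a) -/(evp p b) ha hb.
by case: (f p) => u v; apply/eqP; rewrite eq_complex/=; apply/andP; split; apply/eqP; ring.
Qed.

Lemma gelfand_star_iso : star_iso_CX (gelfand : A -> continuousType X C).
Proof.
split.
  have /choice[g hg] := gelfand_surj.
  by exists g => [x|f]; [apply: gelfand_inj; rewrite hg | exact: hg].
move=> x y k p; have hp := char_ofP p; split.
- exact: (charD hp).
- exact: (charZ hp).
- exact: (charM hp).
- exact: (char_st hp).
Qed.

Hypothesis rr0 : real_rank_eq A 0.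

(** Given a map from a closed set to the two-point sphere, Urysohn's lemma provides a
    continuous function, hence a self-adjoint [a], that is [1 / 2] where the map is [1]
    and [- 1 / 2] where it is [-1].  The sign of an invertible element near [a] is
    continuous on the whole space and extends the map. *)
Lemma lebesgue_dim_char_space : lebesgue_dim_eq R X 0.
Proof.
split=> // F f cF cf fS.
have fE p : F p -> f p ord0 ord0 = 1 \/ f p ord0 ord0 = -1.
  move=> Fp; have : unit_sphere R 0 (f p) by apply: fS; exists p.
  by rewrite /unit_sphere/= big_ord1 => /eqP; rewrite sqrf_eq1 => /orP[]/eqP; [left|right].
pose Fv v := [set p | F p /\ f p ord0 ord0 = v].
have cFv v : closed (Fv v).
  move=> p clp; have Fp : F p by apply: cF; move=> U /clp[q [[]]]; exists q.
  split=> //; have /clp[q [[Fq qv] /(_ Fq)]] := within_continuous_rV1 cf Fp ltr01.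
  rewrite qv ltr_norml; case: (fE p Fp) (fE q Fq) => -> []; rewrite qv => -> /andP[]; lra.
have dis : Fv (-1) `&` Fv 1 = set0.
  by apply/seteqP; split=> // p [[_ h1] [_ h2]]; move: h1; rewrite h2; lra.
have nX : normal_space X by apply: compact_normal; [exact: hausdorff_char_space | exact: compact_char_space].
have /(@uniform_separatorP X R)[g [cg _ g0 g1]] := (proj1 (@normal_separatorP R X) nX) _ _ (cFv _) (cFv _) dis.
have [a sa_a ha] := @evp_surj (fun p => g p - 2^-1) (continuous_subr_cst cg).
have [|z [sz iz az]] := (proj1 (@real_rank0P R A) rr0) a sa_a 2^-1; first by rewrite invr_gt0.
have [s [w [ss s1 qw zE _]]] := polar sz iz.
exists (fun p => const_mx (evp p s)); split.
- exact/continuous_const_rV1/evp_continuous.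
- move=> _ [p _ <-]; rewrite /unit_sphere/= big_ord1 mxE.
  by case: (ev_symmetry (char_ofP p) ss s1); rewrite /evp => ->; ring.
move=> p /set_mem Fp; apply/rowP => i; rewrite mxE (ord1 i).
have hp := char_ofP p; have w0 := ev_isq hp qw.
have : `|evp p a - evp p s * evp p w| < 2^-1.
  rewrite /evp -(evM hp)//; last exact: isq_sa.
  by rewrite -zE -(evB hp); apply: le_lt_trans (ev_le hp (saB _ _)) az.
rewrite ha ltr_norml; case: (fE p Fp) => fp; rewrite fp.
  have -> : g p = 1 by apply: g1; exists p.
  by case: (ev_symmetry hp ss s1); rewrite /evp => -> // /andP[]; lra.
have -> : g p = 0 by apply: g0; exists p.
by case: (ev_symmetry hp ss s1); rewrite /evp => -> // /andP[]; lra.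
Qed.

End Gelfand.

(** * Algebras of continuous functions on zero-dimensional spaces *)

Section FromCX.
Context (R : realType) (A : cstarAlgType R) (X : topologicalType).
Local Notation C := (Cplx R).
Local Notation B := (alg A).
Variable phi : B -> continuousType X C.
Hypothesis phi_iso : star_iso_CX (phi : A -> continuousType X C).
Implicit Types (x y d : B) (t : X).

Let phiD x y t : phi (x + y) t = phi x t + phi y t.
Proof. by have [_ h] := phi_iso; have [] := h x y 0 t. Qed.
Let phiZ (k : C) x t : phi (k *: x) t = k * phi x t.
Proof. by have [_ h] := phi_iso; have [] := h x x k t. Qed.
Let phiM x y t : phi (x * y) t = phi x t * phi y t.
Proof. by have [_ h] := phi_iso; have [] := h x y 0 t. Qed.
Let phi_st x t : phi (st x) t = Num.conj (phi x t).
Proof. by have [_ h] := phi_iso; have [] := h x x 0 t. Qed.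
Let phi_inj x y : (forall t, phi x t = phi y t) -> x = y.
Proof. by move=> h; apply: (bij_inj phi_iso.1); apply/continuousEP => t; exact: h. Qed.
Let phi_surj (f : X -> C) : continuous f -> exists x, forall t, phi x t = f t.
Proof. by move=> cf; have [[g _ gK] _] := phi_iso; exists (g (mkcts cf)) => t; rewrite gK. Qed.

Let phi1 t : phi 1 t = 1.
Proof.
have [|e he] := @phi_surj (fun=> 1); first by apply: cst_continuous.
by have := phiM 1 e t; rewrite mul1r !he mulr1.
Qed.
Let phiB x y t : phi (x - y) t = phi x t - phi y t.
Proof. by rewrite phiD -scaleN1r phiZ mulN1r. Qed.
Let phi_rscal (r : R) t : phi (rscal A r) t = (r%:C)%C.
Proof. by rewrite /rscal /cscal phiZ phi1 mulr1. Qed.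

Lemma CX_commutative : commutative_alg A.
Proof.
have mC (x y : B) : x * y = y * x by apply: phi_inj => t; rewrite !phiM mulrC.
exact: mC.
Qed.

Lemma CX_inv x : (forall t, phi x t != 0) -> inv x.
Proof.
move=> x0; have cx : continuous (phi x) by exact: cts_fun.
have [|y hy] := @phi_surj (fun t => (phi x t)^-1).
  by move=> t; apply: (@cvgV C); [exact: x0 | exact: cx].
by exists y; split; apply: phi_inj => t; rewrite phiM phi1 hy ?mulfV ?mulVf.
Qed.

Lemma CX_real x t : sa x -> phi x t = (complex.Re (phi x t))%:C%C.
Proof.
move=> sx; have := phi_st x t; rewrite sx; case: (phi x t) => u v /= [] vN.
by congr Complex; lra.
Qed.

(** If the norm [m'] of [d] were larger, then [m' ^ 2 - d ^ 2] would have a nowhere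
    vanishing image, so it would be invertible, against [not_inv_norm_sqr].  This
    replaces the automatic isometry of [phi]. *)
Lemma CX_nrm_le d m : 0 <= m -> sa d -> (forall t, `|complex.Re (phi d t)| <= m) ->
  nrm d <= m.
Proof.
move=> m0 sd h; rewrite leNgt; apply/negP => md.
have d0 : d != 0 by rewrite -nrm_eq0 gt_eqF// (le_lt_trans m0).
apply: (not_inv_norm_sqr sd d0); apply: CX_inv => t.
rewrite phiB phi_rscal phiM (CX_real t sd) -rmorphM -rmorphB/=.
apply/eqP => -[] /eqP; rewrite subr_eq0 -expr2 eqf_sqr => /orP e.
have : nrm d = `|complex.Re (phi d t)|.
  case: e => /eqP e; last rewrite -normrN.
    by rewrite -e ger0_norm// nrm_ge0.
  by rewrite -e ger0_norm// nrm_ge0.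
by move=> e'; have := h t; rewrite -e' leNgt md.
Qed.

(** Let [u] be the real function of [x].  Where [|u| >= g], its sign is continuous, and
    zero-dimensionality extends this sign to a continuous [s] with values [1] and [-1]
    on the whole space.  The function [s (|u| + g)] vanishes nowhere and is within
    [3 g] of [u]. *)
Lemma CX_real_rank0 : lebesgue_dim_le R X 0 -> real_rank_eq A 0.
Proof.
move=> dimX; apply/real_rank0P => x sx e e0; pose g := e / 4.
have g0 : 0 < g by rewrite divr_gt0.
pose u t : R := complex.Re (phi x t).
have cu : continuous u by apply: continuous_Re; exact: cts_fun.
have cun : continuous (fun t => `|u t|) by move=> t; apply: cvg_norm; exact: cu.
pose F := [set t | g <= `|u t|].
have cF : closed F.
  apply: (@preimage_closed _ _ (fun t => `|u t|) [set r | g <= r]); last exact: closed_ge.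
  by move=> t _; exact: cun.
have [||G [cG GS GF]] := dimX F (fun t => const_mx (Num.sg (u t))) cF.
- apply: within_continuous_const_rV1 => t Ft d d0.
  have /cvgrPdist_lt/(_ _ g0) := cu t; apply: filterS => t' + _.
  suff : `|u t - u t'| < g -> Num.sg (u t) = Num.sg (u t').
    by move=> h /h ->; rewrite subrr normr0.
  rewrite ltr_norml => /andP[h1 h2]; move: Ft; rewrite /F/= ler_normr => /orP[h|h].
    by rewrite !gtr0_sg//; lra.
  by rewrite !ltr0_sg//; lra.
- move=> _ [t Ft <-]; rewrite /unit_sphere/= big_ord1 mxE sqr_sg.
  by rewrite -normr_gt0 (lt_le_trans g0 Ft).
pose s t : R := G t ord0 ord0.
have cs : continuous s by exact: continuous_rV1_entry.
have s1 t : s t = 1 \/ s t = -1.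
  have : unit_sphere R 0 (G t) by apply: GS; exists t.
  by rewrite /unit_sphere/= big_ord1 => /eqP; rewrite sqrf_eq1 => /orP[]/eqP; [left|right].
have sF t : F t -> s t = Num.sg (u t).
  by move=> /mem_set/GF; rewrite /s => ->; rewrite mxE.
pose v t : R := s t * (`|u t| + g).
have cv : continuous v.
  move=> t; apply: cvgM; first exact: cs.
  by apply: cvgD; [exact: cun | exact: cvg_cst].
have [z hz] := phi_surj (continuous_Complex cv (@cst_continuous X R 0)).
have sz : sa z by apply: phi_inj => t; rewrite phi_st !hz; apply/eqP; rewrite eq_complex/= oppr0 !eqxx.
exists z; split=> //.
  apply: CX_inv => t; rewrite hz eq_complex/= negb_and mulf_neq0//.
    by case: (s1 t) => ->; rewrite ?oppr_eq0 oner_eq0.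
  by rewrite gt_eqF// ltr_wpDl.
suff : nrm (x - z) <= 3 * g by rewrite /g; lra.
apply: CX_nrm_le; [by lra | exact: saB |] => t.
rewrite phiB hz -[phi x t]/(phi x t) (CX_real t sx) -/(u t) /= /v.
have [Ft|Ft] := leP g `|u t|.
  rewrite (sF t Ft) mulrDr -numEsg opprD addrA subrr add0r normrN normrM.
  by rewrite (gtr0_norm g0) normr_sg; case: (_ == 0) => /=; lra.
by case: (s1 t) => ->; move: Ft; rewrite ltr_norml ler_norml; case: (ler0P (u t)) => ? /andP[? ?]; apply/andP; split; lra.
Qed.
End FromCX.

(** * The three equivalent conditions *)

Theorem corollary2p3 (R : realType) (A : cstarAlgType R) :
  (open_map_on (@self_adjoint R A) (@positive_elts R A) (@square R A)
   <-> commutative_alg A /\ real_rank_eq A 0) /\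
  (commutative_alg A /\ real_rank_eq A 0
   <-> exists X : topologicalType,
         [/\ compact [set: X], hausdorff_space X, lebesgue_dim_eq R X 0 &
             exists phi : A -> continuousType X (Cplx R), star_iso_CX phi]).
Proof.
split; first split=> [/square_openP H|[cA rr]].
- by split; [exact: open_commutative | exact: open_real_rank0].
- by apply/square_openP; exact: real_rank0_open.
split=> [[cA rr]|[X [_ _ [dimX _] [phi phi_iso]]]].
  exists (char_space A); split.
  - exact: compact_char_space.
  - exact: hausdorff_char_space.
  - exact: lebesgue_dim_char_space.
  - by exists (@gelfand R A); exact: gelfand_star_iso.
split; first exact: (CX_commutative phi_iso).
exact: (CX_real_rank0 phi_iso dimX).
Qed.
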